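(* There exists a constant $C>0$ such that the following holds. For every $n\in\mathbb{N}$ and every $\varepsilon\in(0,\mathrm{e}^{-1})$, set $$M=M(n,\varepsilon):=\sqrt{24\,(n\log(2n)-\log(\varepsilon))}.$$ Then there exists a ReLU neural network $\tilde H_{n,\varepsilon}:\mathbb{R}\to\mathbb{R}$ such that 1. $\|H_n-\tilde H_{n,\varepsilon}\|_{L^2(\mathbb{R},\gamma_1)}\le 2\varepsilon$; 2. $\tilde H_{n,\varepsilon}(x)=0$ for $|x|>M$, and $\sup_{x\in\mathbb{R}}|\tilde H_{n,\varepsilon}(x)|\le 1+(3M)^n$; 3. $$\operatorname{size}(\tilde H_{n,\varepsilon})\le C\Big(1+n^2\big(\log(n)+\log(-\log(\varepsilon))\big)+n\log\Big(\frac{n}{\varepsilon}\Big)\Big),$$ $$\operatorname{depth}(\tilde H_{n,\varepsilon})\le C\big(1+n\log(n)^2+n\log(n)\log(-\log(\varepsilon))-\log(n)\log(\varepsilon)\big).$$ (The constant $C$ is independent of $n$ and $\varepsilon$.)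
   Context: $\mathbb{N}=\{1,2,\dots\}$; $\log$ is the natural logarithm. $\gamma_1$ is the standard Gaussian measure on $\mathbb{R}$, with Lebesgue density $(2\pi)^{-1/2}\mathrm{e}^{-x^2/2}$. $H_n$ is the $n$th probabilists' Hermite polynomial normalized in $L^2(\mathbb{R},\gamma_1)$: $H_n(x)=\frac{(-1)^n}{\sqrt{n!}}\mathrm{e}^{x^2/2}\frac{d^n}{dx^n}\mathrm{e}^{-x^2/2}$. Neural networks: with $\sigma(x)=\max\{x,0\}$ (ReLU), applied componentwise, a ReLU neural network $\Phi:\mathbb{R}^{n_0}\to\mathbb{R}^{n_{L+1}}$ is a map represented as $\Phi=A_L\circ\sigma\circ\cdots\circ\sigma\circ A_0$ with affine maps $A_j:\mathbb{R}^{n_j}\to\mathbb{R}^{n_{j+1}}$, $A_j(x)=W_jx+b_j$ (no skip connections). Its depth is $\operatorname{depth}(\Phi)=L$, the number of applications of $\sigma$, and $\operatorname{size}(\Phi)$ is the total number of nonzero entries of all weight matrices $W_j$ and bias vectors $b_j$. *)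

(* Defs.v *)
From HB Require Import structures.
From mathcomp Require Import all_boot all_order all_algebra.
From mathcomp Require Import all_classical all_reals all_analysis.

Set Implicit Arguments.
Unset Strict Implicit.
Unset Printing Implicit Defensive.

Import Order.TTheory GRing.Theory Num.Theory.
Import numFieldNormedType.Exports.
Local Open Scope classical_set_scope.
Local Open Scope ring_scope.

(* The standard Gaussian measure; [normal_prob m s] takes the mean and the
   standard deviation (not the variance). *)
Notation gamma1 := (normal_prob 0 1).

(* [derive1n k f] is the k-th derivative of f. *)
Definition hermite (R : realType) (n : nat) (x : R) : R :=
  (-1) ^+ n / Num.sqrt (n`!)%:R * expR (x ^+ 2 / 2)
    * derive1n n (fun t : R => expR (- (t ^+ 2) / 2)) x.

Definition relu (R : realType) (x : R) : R := Num.max x 0.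

(* A representation A_L \o relu \o ... \o relu \o A_0 with A_j v = W_j *m v + b_j.
   [Layer W b N] applies v |-> W *m v + b, then relu componentwise, then N; so
   the head constructor carries A_0 and [Affine] carries the last map A_L.
   Hidden layers have width k.+1, i.e. at least one neuron.
   Depth and size are those of the representation, not of the represented
   function. *)
Inductive relu_net (R : realType) : nat -> nat -> Type :=
| Affine (m p : nat) (W : 'M[R]_(p, m)) (b : 'cV[R]_p) : relu_net R m p
| Layer (m k p : nat) (W : 'M[R]_(k.+1, m)) (b : 'cV[R]_k.+1)
    (N : relu_net R k.+1 p) : relu_net R m p.

Fixpoint realize (R : realType) (m p : nat) (N : relu_net R m p) :
    'cV[R]_m -> 'cV[R]_p :=
  match N in relu_net _ m p return 'cV[R]_m -> 'cV[R]_p with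
  | Affine _ _ W b => fun v => W *m v + b
  | Layer _ _ _ W b N' => fun v => realize N' (map_mx (@relu R) (W *m v + b))
  end.

(* Networks from R to R, identifying R with 'cV[R]_1. *)
Definition realize1 (R : realType) (N : relu_net R 1 1) (x : R) : R :=
  realize N (const_mx x) ord0 ord0.

Fixpoint net_depth (R : realType) (m p : nat) (N : relu_net R m p) : nat :=
  match N with
  | Affine _ _ _ _ => 0
  | Layer _ _ _ _ _ N' => (net_depth N').+1
  end.

Definition nnz (R : realType) (m p : nat) (A : 'M[R]_(m, p)) : nat :=
  #|[set ij : 'I_m * 'I_p | A ij.1 ij.2 != 0]|.

Fixpoint net_size (R : realType) (m p : nat) (N : relu_net R m p) : nat :=
  match N with
  | Affine _ _ W b => nnz W + nnz b
  | Layer _ _ _ W b N' => nnz W + nnz b + net_size N'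
  end.

Definition cutoff (R : realType) (n : nat) (eps : R) : R :=
  Num.sqrt (24 * (n%:R * ln (2 * n%:R) - ln eps)).

(* Main.v *)
Require Import Defs.
From HB Require Import structures.
From mathcomp Require Import all_boot all_order all_algebra.
From mathcomp Require Import all_classical all_reals all_analysis.
From mathcomp Require Import measurable_realfun ring lra zify.

(** Write M for the cut-off radius, L = n ln(2n) + ln(1/eps), so that M^2 = 24 L, and
K = (2M)^n.  The network computes
  clip (K * window M x) (Z * y x),   clip B u = max(-B, min(u, B)),
where window M is a trapezoid equal to 1 on |x| <= 11M/12 and to 0 off |x| <= M,
and Z * y x approximates H_n x up to eps on |x| <= M.  Clipping against the window
makes the output vanish beyond M and bounds it by K everywhere.  It does no harm
inside: |H_n| <= K on |x| <= M, because the three-term recurrence bounds the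
weighted coefficient sum of the monic Hermite polynomial at radius r by (2r)^n as
soon as n <= r^2 ([hermite_poly_coef_bound]).

Accuracy.  On |x| <= 11M/12 the error is at most eps, and elsewhere at most
|H_n| + eps ([clip_dist], [clip_dist_add]).  For |x| >= 11M/12 one has
x^2 >= 20 L, which gives H_n(x)^2 <= eps^2/2 * exp(3x^2/8) ([hermite_tail]).  So
the squared error is everywhere at most eps^2 (2 + exp(3x^2/8)), and the Gaussian
integral of exp(3x^2/8) is 2, because up to the factor 2 the product with the
density is the normal density of standard deviation 2.  The total is 4 eps^2.

Cost.  The polynomial is evaluated by pairing coefficients: from (t; p_0, p_1, ...)
one step produces (t^2; p_0 + p_1 t, p_2 + p_3 t, ...), so about log2 n steps and
O(n) products are enough ([stack_estrin]).  A product is a difference of two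
squares, and a square is computed on [0,1] from m iterates of the tooth map, with
error 4^-(m+1), by O(m) neurons in depth O(m) ([sq_approx_bounds], [madd_level]).
The coefficients, in the variable x/M, are divided by Z = 2^(k+1) (2M)^n, where
2^k > n; this keeps every intermediate value in [-1,1], so that an error of size
4^-(m+1) per product adds up to at most Z 4^k 4^-(m+1).  Making this at most eps
costs m = O(n ln n + n ln ln(1/eps) + ln(1/eps)) ([accuracy_bound]).  Depth is then
O(ln n * m) and size O(n * m), which are the claimed bounds.  For n = 1 the depth
must be bounded independently of eps; there H_1 x = x is read off the clamped
input without any product.

Networks are built as stacks of hidden layers, each layer being the list of the
functions of the input x that its neurons compute.  Stacking layers and running
gadgets in parallel are then list operations, and depth and size are additive.
[stack_net] converts a stack into a network.  A signed value v with |v| <= 1 is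
carried by the single neuron v + 1, on which relu acts as the identity. *)

Set Implicit Arguments.
Unset Strict Implicit.
Unset Printing Implicit Defensive.

Import Order.TTheory GRing.Theory Num.Theory.
Import numFieldNormedType.Exports.
Local Open Scope classical_set_scope.
Local Open Scope ring_scope.

(** * Stacks of hidden layers *)

(** [c] bounds the number of nonzero parameters (weights and bias) of a neuron
whose pre-activation is [h] and whose inputs are the functions in [fs]; the bias is
always counted, hence the strict inequality. *)
Definition affine_in (R : realType) (fs : seq (R -> R)) (c : nat) (h : R -> R) : Prop :=
  exists (b : R) (ws : seq (R * (R -> R))),
    [/\ all (fun w => w.2 \in fs) ws, (size ws < c)%N
      & forall x, h x = b + \sum_(w <- ws) w.1 * w.2 x].

(** [stack d s fs]: some d hidden layers with at most s nonzero parameters, fed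
with the scalar input x, end in a layer whose neurons are the functions in [fs].
The input itself is the layer of depth 0. *)
Inductive stack (R : realType) : nat -> nat -> seq (R -> R) -> Prop :=
| stack_input s : stack 0 s [:: id]
| stack_layer d s c s' fs gs : stack d s fs -> gs != [::] ->
    (s + c * size gs <= s')%N ->
    {in gs, forall g, exists2 h, affine_in fs c h & forall x, g x = relu (h x)} ->
    stack d.+1 s' gs.

Lemma stack_le (R : realType) d s s' (fs : seq (R -> R)) :
  stack d s fs -> (s <= s')%N -> stack d s' fs.
Proof.
case=> [s0|{}d {}s c s1 {}fs gs st gs0 le_s1 gsP] le; first exact: stack_input.
by apply: stack_layer st gs0 _ gsP; exact: leq_trans le.
Qed.

Lemma nnz_sum_rows (R : realType) m p (A : 'M[R]_(m, p)) :
  nnz A = (\sum_(i < m) #|[pred j | A i j != 0%R]|)%N.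
Proof.
rewrite /nnz (eq_card (B := [pred ij | A ij.1 ij.2 != 0])); last first.
  by move=> ij; apply: asboolb.
rewrite -sum1_card (partition_big (fun ij => ij.1) predT) //=.
apply: eq_bigr => i _; rewrite -sum1_card (reindex (fun j => (i, j))) /=; last first.
  by exists snd => [j _ //|[i1 j1]]; rewrite !inE /= => /andP[_ /eqP ->].
by apply: eq_bigl => j; rewrite !inE /= eqxx andbT.
Qed.

(** Repeated functions in the list of weighted inputs are merged into one
matrix entry, which can only lower the number of nonzero weights. *)
Lemma affine_in_row (R : realType) (fs : seq (R -> R)) c h : affine_in fs c h ->
  exists ub : 'rV[R]_(size fs) * R,
    (#|[pred j | ub.1 ord0 j != 0%R]| < c)%N /\
    forall x, h x = ub.2 + \sum_(j < size fs) ub.1 ord0 j * (fs`_j : R -> R) x.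
Proof.
case=> b [ws [/allP ws_fs ws_c hE]].
(* a function listed twice is assigned to its first position in the layer *)
pose sel (w : R * (R -> R)) (j : 'I_(size fs)) := index w.2 fs == j.
exists (\row_j \sum_(w <- ws | sel w j) w.1, b); split=> /=.
  apply: leq_trans ws_c; rewrite ltnS -(size_map (fun w => index w.2 fs)).
  rewrite cardE -(size_map val); apply: uniq_leq_size.
    by rewrite map_inj_uniq ?enum_uniq //; exact: val_inj.
  move=> i /mapP[j]; rewrite mem_enum inE mxE => nz ->{i}.
  apply: contraNT nz => jws; rewrite big_seq_cond big1// => w /andP[wws].
  by move=> /eqP wj; case/negP: jws; apply/mapP; exists w.
move=> x; rewrite hE; congr (_ + _).
under [RHS]eq_bigr do rewrite mxE big_distrl /=.
rewrite (exchange_big_dep predT) //= big_seq [RHS]big_seq.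
apply: eq_bigr => w /ws_fs wfs.
have lt_w : (index w.2 fs < size fs)%N by rewrite index_mem.
rewrite (big_pred1 (Ordinal lt_w)) /= ?nth_index // => j /=.
by apply/eqP/eqP => [wj|-> //]; exact: val_inj.
Qed.

(** Each layer of the stack becomes one [Layer] in front of the network that reads
the last layer, so depths and sizes simply add up. *)
Lemma stack_realize (R : realType) d s (fs : seq (R -> R)) : stack d s fs ->
  forall N : relu_net R (size fs) 1, exists N' : relu_net R 1 1,
    [/\ forall x, realize1 N' x
          = realize N (\col_(i < size fs) (fs`_i : R -> R) x) ord0 ord0,
        net_depth N' = (d + net_depth N)%N
      & (net_size N' <= s + net_size N)%N].
Proof.
elim=> [s0 N|{}d {}s c s' {}fs gs _ IH gs0 le_s' gsP N].
  exists N; split=> //= [x|]; last exact: leq_addl.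
  rewrite /realize1; congr (realize N _ _ _).
  by apply/colP => i; rewrite !mxE ord1.
case: gs gs0 le_s' gsP N => // g gs _ le_s' gsP N; set hs := g :: gs.
have row i : exists ub : 'rV[R]_(size fs) * R,
    (#|[pred j | ub.1 ord0 j != 0%R]| < c)%N /\
    forall x, (hs`_(i : 'I_(size gs).+1) : R -> R) x =
      relu (ub.2 + \sum_(j < size fs) ub.1 ord0 j * (fs`_j : R -> R) x).
  have [h /affine_in_row[ub [cub hE]] gE] := gsP hs`_i (mem_nth 0 (ltn_ord i : (i < size hs)%N)).
  by exists ub; split=> // x; rewrite gE hE.
have [ub ubP] := fin_all_exists row.
pose W := \matrix_(i < (size gs).+1, j < size fs) (ub i).1 ord0 j.
pose b := \col_(i < (size gs).+1) (ub i).2.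
have [N' [N'E N'd N's]] := IH (Layer W b N).
exists N'; split=> [x||].
- rewrite N'E /=; congr (realize N _ _ _); apply/colP => i.
  rewrite !mxE (ubP i).2 addrC; congr (relu (_ + _)).
  by apply: eq_bigr => j _; rewrite !mxE.
- by rewrite N'd /= addnS.
apply: leq_trans N's _; rewrite /= addnA leq_add2r.
apply: leq_trans le_s'; rewrite leq_add2l.
rewrite !nnz_sum_rows -big_split /= mulnC.
apply: (@leq_trans (\sum_(i < (size gs).+1) c)); last first.
  by rewrite sum_nat_const card_ord.
apply: leq_sum => i _; rewrite (eq_card (B := [pred j | (ub i).1 ord0 j != 0])); last first.
  by move=> j; rewrite !inE mxE.
apply: leq_trans (ubP i).1; rewrite -[leqRHS]addn1 leq_add2l.
by apply: leq_trans (max_card _) _; rewrite card_ord.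
Qed.

Lemma stack_net (R : realType) d s (fs : seq (R -> R)) c h :
  stack d s fs -> affine_in fs c h ->
  exists N : relu_net R 1 1,
    [/\ realize1 N =1 h, net_depth N = d & (net_size N <= s + c)%N].
Proof.
move=> st /affine_in_row[[u b] /= [cu hE]].
have [N [NE Nd Ns]] := stack_realize st (Affine u (const_mx b)).
exists N; split=> [x||]; last 1 first.
- apply: leq_trans Ns _; rewrite /= leq_add2l !nnz_sum_rows !big_ord_recl !big_ord0.
  rewrite !addn0; apply: leq_trans cu; rewrite -[leqRHS]addn1 leq_add2l.
  by apply: leq_trans (max_card _) _; rewrite card_ord.
- rewrite NE hE /= !mxE addrC; congr (_ + _).
  by apply: eq_bigr => j _; rewrite mxE.
- by rewrite Nd addn0.
Qed.

Lemma affine_in_comb (R : realType) (fs : seq (R -> R)) c1 c2 (a1 a2 : R) h1 h2 :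
  affine_in fs c1 h1 -> affine_in fs c2 h2 -> affine_in fs (c1 + c2) (fun x => a1 * h1 x + a2 * h2 x).
Proof.
have scale a c h : affine_in fs c h -> affine_in fs c (fun x => a * h x).
  case=> b [ws [wsP wsc hE]]; exists (a * b), [seq (a * w.1, w.2) | w <- ws].
  split; rewrite ?size_map ?all_map // => x.
  rewrite hE mulrDr big_map mulr_sumr; congr (_ + _).
  by apply: eq_bigr => w _; rewrite mulrA.
move=> /(scale a1)[b1 [ws1 [P1 s1 E1]]] /(scale a2)[b2 [ws2 [P2 s2 E2]]].
exists (b1 + b2), (ws1 ++ ws2); split; rewrite ?all_cat ?P1 ?size_cat //.
  by rewrite -addnS leq_add // ltnW.
by move=> x; rewrite E1 E2 big_cat /= addrACA.
Qed.

Lemma affine_in_const (R : realType) (fs : seq (R -> R)) (b : R) : affine_in fs 1 (fun=> b).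
Proof. by exists b, [::]; split=> // x; rewrite big_nil addr0. Qed.

Lemma affine_in_ext (R : realType) (fs : seq (R -> R)) c h h' :
  affine_in fs c h -> h =1 h' -> affine_in fs c h'.
Proof. by case=> b [ws [? ? hE]] hh'; exists b, ws; split=> // x; rewrite -hh'. Qed.

Lemma affine_in_le (R : realType) (fs : seq (R -> R)) c c' h :
  affine_in fs c h -> (c <= c')%N -> affine_in fs c' h.
Proof. by case=> b [ws [? wc hE]] cc'; exists b, ws; split=> //; exact: leq_trans cc'. Qed.

Lemma affine_in_sub (R : realType) (fs gs : seq (R -> R)) c h :
  {subset fs <= gs} -> affine_in fs c h -> affine_in gs c h.
Proof.
move=> fg [b [ws [/allP wfs ? ?]]]; exists b, ws; split=> //.
by apply/allP => w /wfs /fg.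
Qed.

Lemma relu_id (R : realType) (x : R) : 0 <= x -> relu x = x.
Proof. by move=> x0; rewrite /relu max_l. Qed.

(** Equal gadgets run side by side: gadget t occupies the block [L t] of the
current layer, and its next neurons read that block only, so costs add up without
any cross terms. *)
Lemma stack_par (R : realType) (T : eqType) (L L' : T -> seq (R -> R)) (ts : seq T)
    d s c e :
  stack d s (flatten (map L ts)) -> ts != [::] -> (0 < e)%N ->
  {in ts, forall t, size (L' t) = e} ->
  {in ts, forall t, {in L' t, forall g,
     exists2 h, affine_in (L t) c h & forall x, g x = relu (h x)}} ->
  stack d.+1 (s + c * e * size ts) (flatten (map L' ts)).
Proof.
move=> st ts0 e0 sizeL' linL'.
have sizeE : size (flatten (map L' ts)) = (e * size ts)%N.
  rewrite size_flatten /shape -map_comp; elim: ts {st ts0 linL'} sizeL' => [|t ts IH] h /=.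
    by rewrite muln0.
  rewrite h ?mem_head // IH ?mulnS // => u uts; apply: h.
  by rewrite inE uts orbT.
apply: stack_layer st _ _ _ => //.
- by rewrite -size_eq0 sizeE -lt0n muln_gt0 e0 lt0n size_eq0.
- by rewrite sizeE mulnA.
move=> g /flatten_mapP[t tts gt]; have [h hlin gE] := linL' t tts g gt.
exists h => //; apply: affine_in_sub hlin => f ft.
by apply/flatten_mapP; exists t.
Qed.

(** * Approximate squares and products *)

(** On [0,1] this is the tent map, which is 2u up to 1/2 and 2 - 2u beyond. *)
Definition tooth (R : realType) (u : R) : R := 2 * u - 4 * relu (u - 2^-1).

(** The piecewise linear interpolant of u^2 on [0,1] with mesh 2^-k.  It is
written as u minus a sum of scaled tooth iterates, since u - u^2 equals
(g + (g - g^2)) / 4 with g = tooth u. *)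
Fixpoint sq_approx (R : realType) (k : nat) (u : R) : R :=
  if k is j.+1 then sq_approx j u - iter k (@tooth R) u / 4 ^+ k else u.

Lemma tooth_itv (R : realType) (u : R) : 0 <= u <= 1 -> 0 <= tooth u <= 1.
Proof. by move=> /andP[? ?]; rewrite /tooth /relu; case: (leP (u - 2^-1) 0) => ?; lra. Qed.

Lemma iter_tooth_itv (R : realType) k (u : R) :
  0 <= u <= 1 -> 0 <= iter k (@tooth R) u <= 1.
Proof. by move=> u01; elim: k => // k IH; rewrite iterS tooth_itv. Qed.

(** The identity 4 (g - g^2) = tooth g + (tooth g - (tooth g)^2) reproduces the
same remainder one scale further, so the remainder is divided by 4 at each step. *)
Lemma sq_approx_err (R : realType) k (u : R) : 0 <= u <= 1 ->
  let g := iter k (@tooth R) u in sq_approx k u - u ^+ 2 = (g - g ^+ 2) / 4 ^+ k.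
Proof.
move=> u01; elim: k => [|k IH] /=; first by rewrite expr0 divr1.
rewrite addrAC {}IH; have := iter_tooth_itv k u01.
set g := iter k _ u => g01.
have -> : g - g ^+ 2 = (2 * tooth g - tooth g ^+ 2) / 4.
  by rewrite /tooth /relu; case: (leP (g - 2^-1) 0) => _; field.
by rewrite [4 ^+ k.+1]exprSr; field; rewrite expf_neq0.
Qed.

Lemma sq_approx_bounds (R : realType) k (u : R) : 0 <= u <= 1 ->
  u ^+ 2 <= sq_approx k u <= u ^+ 2 + (4 ^+ k.+1)^-1.
Proof.
move=> u01; have := sq_approx_err k u01; have := iter_tooth_itv k u01.
set g := iter k _ u => /andP[g0 g1] /= E.
have q : 0 < (4 ^+ k : R)^-1 by rewrite invr_gt0 exprn_gt0.
rewrite -lerBlDl -[X in X && _]subr_ge0 E [4 ^+ k.+1]exprSr invfM; apply/andP; split.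
  by rewrite mulr_ge0 ?(ltW q)// expr2 subr_ge0 ler_piMr.
rewrite mulrC ler_wpM2l ?(ltW q)//; have := sqr_ge0 (g - 2^-1); nra.
Qed.

(** Polarization with halved arguments, so that both squares are taken in [0,1]
when |u|, |v| <= 1. *)
Definition prod_approx (R : realType) (m : nat) (u v : R) : R :=
  sq_approx m `|(u + v) / 2| - sq_approx m `|(u - v) / 2|.

Lemma half_itv (R : realType) (u v : R) : `|u| <= 1 -> `|v| <= 1 ->
  0 <= `|(u + v) / 2| <= 1 /\ 0 <= `|(u - v) / 2| <= 1.
Proof. by rewrite !normr_ge0 !ler_norml => /andP[? ?] /andP[? ?]; lra. Qed.

(** Both squares are overestimated by at most 4^-(m+1), and one is subtracted
from the other, so the two errors do not add up. *)
Lemma prod_approx_err (R : realType) m (u v : R) : `|u| <= 1 -> `|v| <= 1 ->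
  `|prod_approx m u v - u * v| <= (4 ^+ m.+1)^-1.
Proof.
move=> u1 v1; have [a b] := half_itv u1 v1.
have := sq_approx_bounds m a; have := sq_approx_bounds m b; rewrite /prod_approx.
rewrite !real_normK ?num_real // => /andP[? ?] /andP[? ?].
have -> : u * v = ((u + v) / 2) ^+ 2 - ((u - v) / 2) ^+ 2 by field.
by rewrite ler_norml; lra.
Qed.

Lemma sq_approx0 (R : realType) m : sq_approx m 0 = 0 :> R.
Proof.
have tooth0 : tooth 0 = 0 :> R.
  by rewrite /tooth /relu max_r ?sub0r ?oppr_le0 ?invr_ge0 // !mulr0 subrr.
have iter0 k : iter k (@tooth R) 0 = 0 by elim: k => //= k ->.
by elim: m => //= m ->; rewrite iter0 tooth0 mul0r subrr.
Qed.

Lemma sq_approx_le_id (R : realType) m (u : R) : 0 <= u <= 1 -> sq_approx m u <= u.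
Proof.
move=> u01; elim: m => //= m; apply: le_trans; rewrite lerBlDr lerDl.
have /andP[g0 _] := iter_tooth_itv m.+1 u01.
by rewrite divr_ge0 // exprn_ge0.
Qed.

(** The interpolant of the square stays below the identity on [0,1]: powers of t
computed by repeated squaring never leave [-1,1], whatever their error. *)
Lemma prod_approx_sqr_le1 (R : realType) m (t : R) : `|t| <= 1 -> `|prod_approx m t t| <= 1.
Proof.
move=> t1; rewrite /prod_approx subrr mul0r normr0 sq_approx0 subr0.
rewrite (_ : (t + t) / 2 = t); last by field.
have t01 : 0 <= `|t| <= 1 by rewrite normr_ge0.
have /andP[lb _] := sq_approx_bounds m t01.
rewrite ger0_norm; last exact: le_trans (sqr_ge0 _) lb.
exact: le_trans (sq_approx_le_id m t01) t1.
Qed.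

(** * Multiply-add layers *)

(** The neuron that carries a value v with |v| <= 1. *)
Definition shift1 (R : realType) (v : R -> R) : R -> R := fun x => v x + 1.

Definition madd (R : realType) (m : nat) (t : (R -> R) * (R -> R) * (R -> R)) : R -> R :=
  fun x => t.1.1 x + prod_approx m (t.1.2 x) (t.2 x).

(** The state of a squaring gadget after k steps: the current tooth iterate, its
excess over 1/2, and the current interpolant.  The three of them determine the next
state affinely. *)
Definition sq_neurons (R : realType) (k : nat) (a : R -> R) : seq (R -> R) :=
  [:: fun x => iter k (@tooth R) (a x);
      fun x => relu (iter k (@tooth R) (a x) - 2^-1);
      fun x => sq_approx k (a x)].

Lemma sq_neurons_step (R : realType) k (a : R -> R) (fs : seq (R -> R)) :
  (forall x, 0 <= a x <= 1) -> {subset sq_neurons k a <= fs} ->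
  {in sq_neurons k.+1 a, forall g,
     exists2 h, affine_in fs 4 h & forall x, g x = relu (h x)}.
Proof.
move=> a01 sub.
have lin_step b (w1 w2 w3 : R) : affine_in fs 4 (fun x => b + (w1 * iter k (@tooth R) (a x)
    + (w2 * relu (iter k (@tooth R) (a x) - 2^-1) + w3 * sq_approx k (a x)))).
  apply: (affine_in_sub sub).
  exists b, (zip [:: w1; w2; w3] (sq_neurons k a)); split=> //=.
    by rewrite !inE !eqxx !orbT.
  by move=> x; rewrite !big_cons big_nil addr0.
have iter01 j x := iter_tooth_itv j (a01 x).
move=> g; rewrite !inE => /or3P[] /eqP->.
- exists (fun x => iter k.+1 (@tooth R) (a x)).
    apply: affine_in_ext (lin_step 0 2 (- 4) 0) _ => x.
    by rewrite iterS [in RHS]/tooth; ring.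
  by move=> x; rewrite relu_id //; case/andP: (iter01 k.+1 x).
- exists (fun x => iter k.+1 (@tooth R) (a x) - 2^-1) => //.
  apply: affine_in_ext (lin_step (- 2^-1) 2 (- 4) 0) _ => x.
  by rewrite iterS [in RHS]/tooth; ring.
- exists (fun x => sq_approx k.+1 (a x)).
    apply: affine_in_ext (lin_step 0 (- (2 / 4 ^+ k.+1)) (4 / 4 ^+ k.+1) 1) _ => x /=.
    by rewrite [in RHS]/tooth; ring.
  move=> x; rewrite relu_id //; have /andP[+ _] := sq_approx_bounds k.+1 (a01 x).
  by apply: le_trans; exact: sqr_ge0.
Qed.

(** Depth: one layer for the positive and negative parts of the half sum and
half difference of the factors, m + 1 layers of squaring states, and one output
layer.  A gadget has at most 7 neurons per layer, each with at most 4 parameters. *)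
Lemma madd_level (R : realType) (m d s : nat) (vs : seq (R -> R))
    (ts : seq ((R -> R) * (R -> R) * (R -> R))) :
  stack d s (map (@shift1 R) vs) -> ts != [::] ->
  {in ts, forall t, [/\ affine_in (map (@shift1 R) vs) 2 t.1.1,
     affine_in (map (@shift1 R) vs) 2 t.1.2 & affine_in (map (@shift1 R) vs) 2 t.2]} ->
  {in ts, forall t x, [/\ `|t.1.1 x| <= 1, `|t.1.2 x| <= 1, `|t.2 x| <= 1
     & `|madd m t x| <= 1]} ->
  stack (d + (m + 3)) (s + 28 * (m + 3) * size ts)
    (map (@shift1 R) (map (madd m) ts)).
Proof.
move=> st ts0 tlin tbound.
pose T := ((R -> R) * (R -> R) * (R -> R))%type.
pose hs (t : T) : R -> R := fun x => (t.1.2 x + t.2 x) / 2.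
pose hd (t : T) : R -> R := fun x => (t.1.2 x - t.2 x) / 2.
pose LA (t : T) : seq (R -> R) :=
  [:: (fun x => relu (hs t x)); (fun x => relu (- hs t x));
      (fun x => relu (hd t x)); (fun x => relu (- hd t x)); shift1 t.1.1].
pose LB k (t : T) : seq (R -> R) :=
  sq_neurons k (fun x => `|hs t x|) ++ sq_neurons k (fun x => `|hd t x|)
    ++ [:: shift1 t.1.1].
have hs01 t : t \in ts -> forall x, 0 <= `|hs t x| <= 1.
  by move=> tts x; have [_ q r _] := tbound t tts x; have [] := half_itv q r.
have hd01 t : t \in ts -> forall x, 0 <= `|hd t x| <= 1.
  by move=> tts x; have [_ q r _] := tbound t tts x; have [] := half_itv q r.
have p1 t : t \in ts -> forall x, relu (shift1 t.1.1 x) = shift1 t.1.1 x.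
  move=> tts x; have [p _ _ _] := tbound t tts x; rewrite relu_id // /shift1.
  by move: p; rewrite ler_norml; lra.
have sizefl (e : nat) (L : T -> seq (R -> R)) : (forall t, size (L t) = e) ->
    size (flatten (map L ts)) = (e * size ts)%N.
  by move=> h; elim: (ts) => [|t ts' IH] /=; rewrite ?muln0 // size_cat h IH mulnS.
have flat0 (e : nat) (L : T -> seq (R -> R)) : (forall t, size (L t) = e.+1) ->
    flatten (map L ts) != [::].
  by move=> h; rewrite -size_eq0 (sizefl _ _ h) muln_eq0 size_eq0.
have stA : stack d.+1 (s + 4 * (5 * size ts)) (flatten (map LA ts)).
  apply: (stack_layer (c := 4) st) => //; first exact: (flat0 4).
    by rewrite (sizefl 5%N).
  have linD t a1 a2 : t \in ts -> affine_in (map (@shift1 R) vs) 4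
      (fun x => a1 * t.1.2 x + a2 * t.2 x).
    by move=> /tlin[_ q r]; exact: (affine_in_comb a1 a2 q r).
  move=> g /flatten_mapP[t tts]; rewrite !inE.
  case/or4P => [/eqP->|/eqP->|/eqP->|/orP[]/eqP->].
  - exists (hs t) => //; apply: affine_in_ext (linD t 2^-1 2^-1 tts) _ => x.
    by rewrite /hs; ring.
  - exists (fun x => - hs t x) => //.
    by apply: affine_in_ext (linD t (- 2^-1) (- 2^-1) tts) _ => x; rewrite /hs; ring.
  - exists (hd t) => //; apply: affine_in_ext (linD t 2^-1 (- 2^-1) tts) _ => x.
    by rewrite /hd; ring.
  - exists (fun x => - hd t x) => //.
    by apply: affine_in_ext (linD t (- 2^-1) 2^-1 tts) _ => x; rewrite /hd; ring.
  exists (shift1 t.1.1) => [|x]; last by rewrite p1.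
  have [p _ _] := tlin t tts.
  apply: affine_in_le (affine_in_ext (affine_in_comb 1 1 p (affine_in_const _ 1)) _) _ => // x.
  by rewrite /shift1 !mul1r.
have absE (y : R) : `|y| = relu y + relu (- y).
  have relu0 (z : R) : z <= 0 -> relu z = 0 by move=> z0; rewrite /relu max_r.
  case: (leP 0 y) => y0.
    by rewrite ger0_norm // (relu_id y0) relu0 ?addr0 // oppr_le0.
  by rewrite ltr0_norm // relu0 ?(ltW y0) // relu_id ?add0r // oppr_ge0 ltW.
have absP (f1 f2 : R -> R) (h : R -> R) fs : f1 \in fs -> f2 \in fs ->
    (forall x, f1 x = relu (h x)) -> (forall x, f2 x = relu (- h x)) ->
    {in sq_neurons 0 (fun x => `|h x|), forall g,
      exists2 h, affine_in fs 4 h & forall x, g x = relu (h x)}.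
  move=> f1fs f2fs f1E f2E.
  have habs b : affine_in fs 4 (fun x => `|h x| + b).
    exists b, [:: (1, f1); (1, f2)]; split=> //=; first by rewrite f1fs f2fs.
    move=> x; rewrite !big_cons big_nil addr0 /= !mul1r addrC f1E f2E.
    by rewrite -absE.
  move=> g; rewrite !inE => /or3P[] /eqP->.
  - by exists (fun x => `|h x| + 0) => // x; rewrite /= addr0 relu_id.
  - by exists (fun x => `|h x| - 2^-1).
  - by exists (fun x => `|h x| + 0) => // x; rewrite /= addr0 relu_id.
have keep t fs : t \in ts -> shift1 t.1.1 \in fs ->
    exists2 h, affine_in fs 4 h & forall x, shift1 t.1.1 x = relu (h x).
  move=> tts pfs; exists (shift1 t.1.1) => [|x]; last by rewrite p1.
  exists 0, [:: (1, shift1 t.1.1)]; split=> //=; first by rewrite pfs.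
  by move=> x; rewrite big_cons big_nil add0r addr0 mul1r.
have stB k : stack (d.+2 + k) (s + 4 * (5 * size ts) + 28 * k.+1 * size ts)
    (flatten (map (LB k) ts)).
  elim: k => [|k IH].
    rewrite addn0 muln1 -[28%N]/(4 * 7)%N; apply: stack_par stA _ _ _ _ => //.
    move=> t tts g; rewrite !mem_cat => /or3P[].
    - by apply: (absP (fun x => relu (hs t x)) (fun x => relu (- hs t x)));
        rewrite // !inE eqxx ?orbT.
    - by apply: (absP (fun x => relu (hd t x)) (fun x => relu (- hd t x)));
        rewrite // !inE eqxx ?orbT.
    - by rewrite inE => /eqP->; apply: keep => //; rewrite !inE eqxx !orbT.
  have -> : (s + 4 * (5 * size ts) + 28 * k.+2 * size ts =
      s + 4 * (5 * size ts) + 28 * k.+1 * size ts + 4 * 7 * size ts)%N by lia.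
  rewrite addnS.
  apply: stack_par IH _ _ _ _ => //.
  move=> t tts g; rewrite !mem_cat => /or3P[].
  - by apply: sq_neurons_step; [exact: hs01|move=> f ft; rewrite /LB mem_cat ft].
  - apply: sq_neurons_step; first exact: hd01.
    by move=> f ft; rewrite /LB !mem_cat ft orbT.
  - by rewrite inE => /eqP->; apply: keep => //; rewrite /LB !mem_cat mem_seq1 eqxx !orbT.
have -> : map (@shift1 R) (map (madd m) ts)
    = flatten (map (fun t => [:: shift1 (madd m t)]) ts).
  by elim: (ts) => //= t ts' ->.
have -> : (d + (m + 3) = (d.+2 + m).+1)%N by lia.
apply: (stack_layer (c := 4) (stB m)); first exact: (flat0 0%N).
  by rewrite (sizefl 1%N) //; nia.
move=> g /flatten_mapP[t tts]; rewrite inE => /eqP->.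
exists (shift1 (madd m t)) => [|x]; last first.
  have [_ _ _] := tbound t tts x; rewrite ler_norml => b.
  by rewrite relu_id // /shift1; lra.
apply: (@affine_in_sub _ (LB m t)).
  by move=> f ft; apply/flatten_mapP; exists t.
exists 0, [:: (1, shift1 t.1.1); (1, fun x => sq_approx m `|hs t x|);
  (-1, fun x => sq_approx m `|hd t x|)]; split=> //=.
  by rewrite !inE !eqxx !orbT.
move=> x; rewrite !big_cons big_nil /= /shift1 /madd /prod_approx -/(hs t x) -/(hd t x).
by ring.
Qed.

(** * Parallel evaluation of a polynomial *)

(** The polynomial with coefficient list [cs], lowest degree first, at t; it
serves as the exact reference against which the network's values are compared. *)
Definition horner_seq (R : realType) (cs : seq R) (t : R) : R :=
  foldr (fun c a => c + t * a) 0 cs.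

Lemma horner_seq_bound (R : realType) (cs : seq R) (t : R) : `|t| <= 1 ->
  {in cs, forall c, `|c| <= 1} -> `|horner_seq cs t| <= (size cs)%:R.
Proof.
move=> t1; elim: cs => [|c cs IH] h /=; first by rewrite normr0.
apply: le_trans (ler_normD _ _) _; rewrite mulrS lerD ?h ?mem_head // normrM.
rewrite -[leRHS]mul1r ler_pM // IH // => c' c'cs; apply: h.
by rewrite inE c'cs orbT.
Qed.

(** A perturbation of size e of a coefficient contributes at most e, and one of
the argument contributes at most e times the degree, per coefficient; both sum to
at most the square of the length times e. *)
Lemma horner_seq_dist (R : realType) (T : eqType) (f g : T -> R) (l : seq T) (s t e : R) :
  `|s| <= 1 -> `|t| <= 1 -> `|s - t| <= e ->
  {in l, forall i, `|f i| <= 1} -> {in l, forall i, `|f i - g i| <= e} ->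
  `|horner_seq (map f l) s - horner_seq (map g l) t| <= (size l)%:R ^+ 2 * e.
Proof.
move=> s1 t1 st; have e0 : 0 <= e by exact: le_trans (normr_ge0 _) st.
elim: l => [|i l IH] f1 fg /=; first by rewrite subrr normr0 expr0n mul0r.
have tl j : j \in l -> j \in i :: l by move=> jl; rewrite inE jl orbT.
have {}IH := IH (fun j jl => f1 j (tl j jl)) (fun j jl => fg j (tl j jl)).
have bf : `|horner_seq (map f l) s| <= (size l)%:R.
  by rewrite -(size_map f) horner_seq_bound // => _ /mapP[j jl ->]; exact: f1 (tl j jl).
move: IH bf; set a := horner_seq _ s; set a' := horner_seq _ t; set n := (size l)%:R => IH bf.
have -> : f i + s * a - (g i + t * a') = (f i - g i) + ((s - t) * a + t * (a - a')).
  by ring.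
have n0 : 0 <= n :> R by exact: ler0n.
have h1 : `|f i - g i| <= e by apply: fg; exact: mem_head.
have h2 : `|(s - t) * a| <= e * n by rewrite normrM ler_pM.
have h3 : `|t * (a - a')| <= n ^+ 2 * e.
  by rewrite normrM -[leRHS]mul1r ler_pM.
apply: le_trans (ler_normD _ _) _; apply: le_trans (lerD h1 (ler_normD _ _)) _.
have ne : 0 <= n * e by exact: mulr_ge0.
rewrite mulrS -/n; apply: le_trans (lerD (lexx e) (lerD h2 h3)) _.
by nra.
Qed.

(** The gadget (p, q, t) is to compute p + q t. *)
Fixpoint pair_up (R : realType) (t : R -> R) (ps : seq (R -> R)) :
    seq ((R -> R) * (R -> R) * (R -> R)) :=
  match ps with
  | p :: q :: ps' => (p, q, t) :: pair_up t ps'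
  | [:: p] => [:: (p, cst 0, t)]
  | [::] => [::]
  end.

Lemma seq_pair_ind (T : Type) (P : seq T -> Prop) :
  P [::] -> (forall p, P [:: p]) -> (forall p q s, P s -> P (p :: q :: s)) ->
  forall s, P s.
Proof.
move=> P0 P1 P2 s; suff [] : P s /\ forall p, P (p :: s) by [].
by elim: s => [|q s [IH IH']]; split=> // p; apply: P2.
Qed.

Lemma mem_pair_up (R : realType) (t : R -> R) ps :
  {in pair_up t ps, forall u, [/\ u.1.1 \in ps, u.1.2 \in cst 0 :: ps & u.2 = t]}.
Proof.
elim/seq_pair_ind: ps => [|p|p q ps IH] //= u; rewrite inE.
  by move=> /eqP->; rewrite !inE !eqxx.
case/orP => [/eqP->|/IH[u1 u2 u3]]; first by rewrite !inE !eqxx !orbT.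
split=> //; first by rewrite !inE u1 !orbT.
by move: u2; rewrite !inE => /orP[->|->]; rewrite ?orbT.
Qed.

Lemma size_pair_up (R : realType) (t : R -> R) ps :
  size (pair_up t ps) = uphalf (size ps).
Proof. by elim/seq_pair_ind: ps => //= p q ps ->. Qed.

(** Splitting a polynomial into its even and odd parts,
sum p_i t^i = sum (p_(2i) + p_(2i+1) t) t^(2i). *)
Lemma horner_seq_pair_up (R : realType) (t : R -> R) ps (x : R) :
  horner_seq (map (fun u => u.1.1 x + u.1.2 x * u.2 x) (pair_up t ps)) (t x ^+ 2)
  = horner_seq (map (fun p => p x) ps) (t x).
Proof.
elim/seq_pair_ind: ps => [|p|p q ps IH] //=; first by rewrite /cst; ring.
by rewrite IH; ring.
Qed.

(** The hypothesis 2^k (b + e) <= 1 is invariant: one step halves 2^k and turns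
the coefficient bound b into 2b + e.  With all coefficients bounded by 1, one step
perturbs the value by at most (2^(k-1))^2 e, and these sum to at most 4^k e.  The
function [phi] is carried along for the final clipping. *)
Lemma stack_estrin (R : realType) m k d s (phi t : R -> R) ps (b : R) :
  let e := (4 ^+ m.+1)^-1 in
  stack d s (map (@shift1 R) (phi :: t :: ps)) -> ps != [::] ->
  (size ps <= 2 ^ k)%N ->
  (forall x, `|phi x| <= 1) -> (forall x, `|t x| <= 1) ->
  {in ps, forall p x, `|p x| <= b} -> 2 ^+ k * (b + e) <= 1 ->
  exists t' y, stack (d + k * (m + 3)) (s + 28 * (m + 3) * (3 * (2 ^ k - 1)))
      (map (@shift1 R) [:: phi; t'; y]) /\
    forall x, `|y x - horner_seq (map (fun p => p x) ps) (t x)| <= 4 ^+ k * e.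
Proof.
move=> e; have e0 : 0 < e by rewrite invr_gt0 exprn_gt0.
elim: k d s t ps b => [|k IH] d s t ps b st ps0 sz phi1 t1 psb be.
  case: ps ps0 sz st psb => [//|p [|//]] _ _ st _.
  exists t, p; split=> [|x]; last by rewrite /= mulr0 addr0 subrr normr0 mulr_ge0 ?exprn_ge0 ?ltW.
  by rewrite subnn muln0 muln0 addn0 addn0.
have b0 : 0 <= b.
  by case: ps ps0 {st sz} psb => // p ps _ /(_ p (mem_head _ _) 0); apply: le_trans.
have k1 : 1 <= 2 ^+ k :> R by rewrite exprn_ege1 // ler1n.
have be2 : 2 * (b + e) <= 1.
  by move: be; rewrite exprSr; nra.
have b1 : b <= 1 by lra.
pose ts := (phi, cst 0, cst 0) :: (cst 0, t, t) :: pair_up t ps.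
have q0b q : q \in cst 0 :: ps -> forall x, `|q x| <= b.
  by rewrite inE => /orP[/eqP-> x|/psb//]; rewrite normr0.
have maddb u : u \in pair_up t ps -> forall x,
    `|madd m u x - (u.1.1 x + u.1.2 x * u.2 x)| <= e /\ `|madd m u x| <= 2 * b + e.
  move=> /mem_pair_up[pin qin ut] x; rewrite /madd.
  have pb := psb _ pin x; have qb := q0b _ qin x.
  have := prod_approx_err m (le_trans qb b1) (t1 x); rewrite ut -/e => er.
  split; first by rewrite opprD addrACA subrr add0r.
  have -> : u.1.1 x + prod_approx m (u.1.2 x) (t x) =
    u.1.1 x + (u.1.2 x * t x + (prod_approx m (u.1.2 x) (t x) - u.1.2 x * t x)) by ring.
  have qtb : `|u.1.2 x * t x| <= b.
    by rewrite normrM -[leRHS]mulr1 ler_pM.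
  apply: le_trans (ler_normD _ _) _; apply: le_trans (lerD pb (ler_normD _ _)) _.
  by apply: le_trans (lerD (lexx b) (lerD qtb er)) _; lra.
have memS f : f \in phi :: t :: ps -> affine_in (map (@shift1 R) (phi :: t :: ps)) 2 f.
  move=> fin; exists (-1), [:: (1, shift1 f)]; split=> //=.
    by rewrite andbT; exact: (map_f (@shift1 R) fin).
  by move=> x; rewrite big_cons big_nil /shift1 /=; ring.
have lin0 : affine_in (map (@shift1 R) (phi :: t :: ps)) 2 (cst 0).
  exact: affine_in_le (affine_in_const _ 0) _.
have memp f : f \in ps -> f \in phi :: t :: ps by move=> fin; rewrite !inE fin !orbT.
have tsl : {in ts, forall u, [/\ affine_in (map (@shift1 R) (phi :: t :: ps)) 2 u.1.1,
     affine_in (map (@shift1 R) (phi :: t :: ps)) 2 u.1.2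
   & affine_in (map (@shift1 R) (phi :: t :: ps)) 2 u.2]}.
  move=> u; rewrite !inE => /or3P[/eqP->|/eqP->|/mem_pair_up[pin qin ->]] /=.
  - by split=> //; apply: memS; rewrite mem_head.
  - by split=> //; apply: memS; rewrite !inE eqxx orbT.
  split; first by apply/memS/memp.
    by move: qin; rewrite inE => /orP[/eqP->//|qin]; apply/memS/memp.
  by apply: memS; rewrite !inE eqxx orbT.
have tsb : {in ts, forall u x, [/\ `|u.1.1 x| <= 1, `|u.1.2 x| <= 1, `|u.2 x| <= 1
     & `|madd m u x| <= 1]}.
  move=> u; rewrite !inE => /or3P[/eqP->|/eqP->|uin] x /=.
  - rewrite /madd /= /prod_approx addr0 subrr mul0r normr0 sq_approx0 subrr addr0.
    by split.
  - by rewrite /madd /= add0r prod_approx_sqr_le1 // normr0.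
  have [_ mb] := maddb u uin x; have [pin qin ut] := mem_pair_up uin.
  split; rewrite ?ut //.
  - exact: le_trans (psb _ pin x) b1.
  - exact: le_trans (q0b _ qin x) b1.
  by apply: le_trans mb _; lra.
have st1 := madd_level st (isT : ts != [::]) tsl tsb.
(* a gadget with zero factors reproduces its summand exactly *)
have phiE : madd m (phi, cst 0, cst 0) = phi.
  by apply/funext => x; rewrite /madd /= /prod_approx addr0 subrr mul0r normr0 sq_approx0 subrr addr0.
rewrite /= phiE in st1; set t2 := madd m (cst 0, t, t) in st1.
have t2E x : t2 x = prod_approx m (t x) (t x) by rewrite /t2 /madd add0r.
have t21 x : `|t2 x| <= 1 by rewrite t2E prod_approx_sqr_le1.
have psz : (size (pair_up t ps) <= 2 ^ k)%N.
  by rewrite size_pair_up leq_uphalf_double -muln2 -expnSr.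
have [||||||t' [y [sty yE]]] := IH _ _ t2 (map (madd m) (pair_up t ps)) (2 * b + e) st1.
- by rewrite -size_eq0 size_map size_pair_up -lt0n uphalf_gt0 lt0n size_eq0.
- by rewrite size_map.
- by [].
- by [].
- by move=> _ /mapP[u uin ->] x; have [] := maddb u uin x.
- by move: be; rewrite exprSr; apply: le_trans; rewrite -mulrA ler_pM2l ?exprn_gt0 //; lra.
exists t', y; split=> [|x].
  move: sty; have -> : (d + (m + 3) + k * (m + 3) = d + k.+1 * (m + 3))%N by lia.
  move=> sty; apply: stack_le sty _; rewrite -addnA leq_add2l -mulnDr leq_mul2l.
  apply/orP; right; rewrite /ts /=; have := expn_gt0 2 k; rewrite expnS.
  by move: psz; set z := (2 ^ k)%N; lia.
apply: le_trans (ler_distD (horner_seq (map (fun p => p x) (map (madd m) (pair_up t ps))) (t2 x)) _ _) _.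
rewrite exprS (_ : 4 * 4 ^+ k = 4 ^+ k + 3 * 4 ^+ k); last by ring.
rewrite mulrDl lerD //; rewrite -(horner_seq_pair_up t ps) -(map_comp (fun p : R -> R => p x) (madd m)) distrC.
have p4 : 0 < 4 ^+ k :> R by rewrite exprn_gt0.
apply: (@le_trans _ _ (4 ^+ k * e)); last by rewrite ler_pM2r //; lra.
apply: (@le_trans _ _ ((size (pair_up t ps))%:R ^+ 2 * e)); last first.
  rewrite ler_pM2r // (_ : 4 = 2 ^+ 2 :> R); last by ring.
  rewrite -exprM mulnC exprM lerXn2r ?nnegrE ?exprn_ge0 //.
  by rewrite -natrX ler_nat.
rewrite distrC; apply: horner_seq_dist.
- exact: t21.
- by rewrite normrX exprn_ile1.
- by rewrite t2E expr2 prod_approx_err.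
- by move=> u uin; have [_] := maddb u uin x; rewrite /=; lra.
- by move=> u uin; have [] := maddb u uin x.
Qed.

Lemma horner_seq_mkseq (R : realType) (f : nat -> R) n (t : R) :
  horner_seq (mkseq f n) t = \sum_(i < n) f i * t ^+ i.
Proof.
elim: n f => [|n IH] f; first by rewrite big_ord0.
rewrite /mkseq /= -[1%N]addn0 iotaDl -map_comp -/(mkseq _ _) IH big_ord_recl.
rewrite expr0 mulr1 mulr_sumr; congr (_ + _).
by apply: eq_bigr => i _; rewrite /= exprS mulrCA.
Qed.

(** * Cut-offs and clipping *)

(** A trapezoid: 1 on |x| <= 11M/12, 0 on |x| >= M, affine in between. *)
Definition window (R : realType) (M x : R) : R :=
  12 * (relu (x / M + 1) - relu (x / M + 11 / 12)
        - relu (x / M - 11 / 12) + relu (x / M - 1)).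

(** x/M truncated to [-1,1]. *)
Definition clamp (R : realType) (M x : R) : R :=
  relu (x / M + 1) - relu (x / M - 1) - 1.

(** For B >= 0 this is y truncated to [-B,B]. *)
Definition clip (R : realType) (B y : R) : R := relu (y + B) - relu (y - B) - B.

Lemma reluP (R : realType) (x : R) :
  (0 <= x /\ relu x = x) \/ (x <= 0 /\ relu x = 0).
Proof.
case: (leP 0 x) => x0; first by left; rewrite relu_id.
by right; rewrite /relu max_r ?ltW.
Qed.

Lemma window_itv (R : realType) (M x : R) : 0 <= window M x <= 1.
Proof.
rewrite /window; move: (x / M) => z.
have := reluP (z + 1); have := reluP (z + 11 / 12).
have := reluP (z - 11 / 12); have := reluP (z - 1).
by move=> [] [? ->] [] [? ->] [] [? ->] [] [? ->]; lra.
Qed.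

Lemma window1 (R : realType) (M x : R) : 0 < M -> `|x| <= 11 / 12 * M -> window M x = 1.
Proof.
move=> M0 xM; have : `|x / M| <= 11 / 12 by rewrite normrM normfV (gtr0_norm M0) ler_pdivrMr.
rewrite /window ler_norml; move: (x / M) => z /andP[? ?].
have := reluP (z + 1); have := reluP (z + 11 / 12).
have := reluP (z - 11 / 12); have := reluP (z - 1).
by move=> [] [? ->] [] [? ->] [] [? ->] [] [? ->]; lra.
Qed.

Lemma window0 (R : realType) (M x : R) : 0 < M -> M < `|x| -> window M x = 0.
Proof.
move=> M0 xM; have : 1 <= `|x / M|.
  by rewrite normrM normfV (gtr0_norm M0) ler_pdivlMr // mul1r ltW.
rewrite /window ler_normr; move: (x / M) => z z1.
have := reluP (z + 1); have := reluP (z + 11 / 12).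
have := reluP (z - 11 / 12); have := reluP (z - 1).
by case/orP: z1 => ?; move=> [] [? ->] [] [? ->] [] [? ->] [] [? ->]; lra.
Qed.

Lemma clamp_le1 (R : realType) (M x : R) : `|clamp M x| <= 1.
Proof.
rewrite /clamp; move: (x / M) => z; rewrite ler_norml.
have := reluP (z + 1); have := reluP (z - 1).
by move=> [] [? ->] [] [? ->]; lra.
Qed.

Lemma clampE (R : realType) (M x : R) : 0 < M -> `|x| <= M -> clamp M x = x / M.
Proof.
move=> M0 xM; have : `|x / M| <= 1.
  by rewrite normrM normfV (gtr0_norm M0) ler_pdivrMr // mul1r.
rewrite /clamp ler_norml; move: (x / M) => z /andP[? ?].
have := reluP (z + 1); have := reluP (z - 1).
by move=> [] [? ->] [] [? ->]; lra.
Qed.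

Lemma clip0 (R : realType) (y : R) : clip 0 y = 0.
Proof. by rewrite /clip addr0 !subr0 subrr. Qed.

Lemma clip_bound (R : realType) (B y : R) : 0 <= B -> `|clip B y| <= B.
Proof.
move=> B0; rewrite /clip ler_norml; have := reluP (y + B); have := reluP (y - B).
by move=> [] [? ->] [] [? ->]; lra.
Qed.

(** Truncation to [-B,B] is 1-Lipschitz and fixes h. *)
Lemma clip_dist (R : realType) (B y h : R) :
  `|h| <= B -> `|clip B y - h| <= `|y - h|.
Proof.
rewrite ler_norml /clip => /andP[? ?]; have := reluP (y + B); have := reluP (y - B).
have := ler_norm (y - h); have := ler_norm (h - y); rewrite (distrC h y) => ? ?.
by rewrite ler_norml; move=> [] [? ->] [] [? ->]; lra.
Qed.

(** The truncated value lies between 0 and y, so its distance to h is at most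
the larger of |h| and |y - h|. *)
Lemma clip_dist_add (R : realType) (B y h : R) : 0 <= B ->
  `|clip B y - h| <= `|h| + `|y - h|.
Proof.
move=> B0; rewrite /clip.
have := ler_norm (y - h); have := ler_norm (h - y); rewrite (distrC h y).
have := ler_norm h; have := ler_norm (- h); rewrite normrN.
have [p q] : (0 <= `|h|) /\ (0 <= `|y - h|) by [].
move: `|h| `|y - h| p q => a b ? ? ? ? ? ?; rewrite ler_norml.
have := reluP (y + B); have := reluP (y - B).
by move=> [] [? ->] [] [? ->]; lra.
Qed.

(** Two layers: the four kinks of the window and of the clamp, then the window,
the clamped input and the constants. *)
Lemma stack_start (R : realType) (M : R) (cs : seq R) : {in cs, forall c, `|c| <= 1} ->
  stack 2 (18 + 5 * size cs)
    (map (@shift1 R) (window M :: clamp M :: map (fun c => cst c) cs)).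
Proof.
move=> cs1; pose r (b x : R) := relu (x / M + b).
pose fs : seq (R -> R) := [:: r 1; r (11 / 12); r (- (11 / 12)); r (- 1)].
have st1 : stack 1 8 fs.
  apply: (stack_layer (c := 2) (stack_input R 0)) => //.
  have h b : exists2 h, affine_in [:: id] 2 h & forall x, r b x = relu (h x).
    exists (fun x => x / M + b) => //; exists b, [:: (M^-1, id)].
    split=> //=; first by rewrite mem_head.
    by move=> x; rewrite big_cons big_nil /=; ring.
  by move=> g; rewrite !inE => /or4P[] /eqP->; exact: h.
apply: (stack_layer (c := 5) st1) => //; first by rewrite /= !size_map; lia.
have lin4 b w1 w2 w3 w4 : affine_in fs 5 (fun x =>
    b + (w1 * r 1 x + (w2 * r (11 / 12) x + (w3 * r (- (11 / 12)) x + w4 * r (- 1) x)))).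
  exists b, (zip [:: w1; w2; w3; w4] fs); split=> //=.
    by rewrite !inE !eqxx !orbT.
  by move=> x; rewrite !big_cons big_nil addr0.
have keep (v : R -> R) : (forall x, `|v x| <= 1) -> affine_in fs 5 (shift1 v) ->
    exists2 h, affine_in fs 5 h & forall x, shift1 v x = relu (h x).
  move=> v1 vl; exists (shift1 v) => // x; rewrite relu_id // /shift1.
  by have := v1 x; rewrite ler_norml; lra.
move=> g /mapP[v + ->]; rewrite !inE => /or3P[/eqP->|/eqP->|/mapP[c ccs ->]].
- apply: keep.
    by move=> x; have /andP[? ?] := window_itv M x; rewrite ger0_norm.
  apply: affine_in_ext (lin4 1 12 (- 12) (- 12) 12) _ => x.
  by rewrite /shift1 /window /r; ring.
- apply: keep; first exact: clamp_le1.
  apply: affine_in_ext (lin4 0 1 0 0 (- 1)) _ => x.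
  by rewrite /shift1 /clamp /r; ring.
- apply: keep; first by move=> x; exact: cs1.
  by apply: affine_in_le (affine_in_ext (affine_in_const fs (c + 1)) _) _.
Qed.

Lemma stack_clip (R : realType) d s (vs : seq (R -> R)) (phi y : R -> R) (K c : R) :
  stack d s (map (@shift1 R) vs) -> phi \in vs -> y \in vs ->
  0 <= K -> (forall x, 0 <= phi x) ->
  exists N : relu_net R 1 1,
    [/\ realize1 N =1 (fun x => clip (K * phi x) (c * y x)),
        net_depth N = d.+1 & (net_size N <= s + 16)%N].
Proof.
move=> st phiin yin K0 phi0.
have unshift v : v \in vs -> affine_in (map (@shift1 R) vs) 2 v.
  move=> vin; exists (-1), [:: (1, shift1 v)]; split=> //=.
    by rewrite andbT; exact: (map_f (@shift1 R) vin).
  by move=> x; rewrite big_cons big_nil /shift1 /=; ring.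
pose f1 x := relu (c * y x + K * phi x); pose f2 x := relu (c * y x - K * phi x).
have st1 : stack d.+1 (s + 12) [:: f1; f2; phi].
  apply: (stack_layer (c := 4) st) => // g; rewrite !inE => /or3P[]/eqP->.
  - exists (fun x => c * y x + K * phi x) => //.
    exact: affine_in_comb (unshift _ yin) (unshift _ phiin).
  - exists (fun x => c * y x - K * phi x) => //.
    apply: affine_in_ext (affine_in_comb c (- K) (unshift _ yin) (unshift _ phiin)) _ => x.
    by rewrite mulNr.
  by exists phi => [|x]; [exact: affine_in_le (unshift _ phiin) _|rewrite relu_id].
have [|N [NE Nd Ns]] := @stack_net R _ _ _ 4 (fun x => clip (K * phi x) (c * y x)) st1.
  exists 0, [:: (1, f1); (- 1, f2); (- K, phi)]; split=> //=.
    by rewrite !inE !eqxx !orbT.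
  by move=> x; rewrite !big_cons big_nil /f1 /f2 /clip /=; ring.
by exists N; split=> //; rewrite -addnA in Ns.
Qed.

(** * Hermite polynomials *)

(** Monic Hermite polynomials, defined by what differentiating p(x) exp(-x^2/2)
does to p. *)
Fixpoint hermite_poly (R : realType) (n : nat) : {poly R} :=
  if n is m.+1 then 'X * hermite_poly R m - (hermite_poly R m)^`()%R else 1.

Lemma derive1n_gauss (R : realType) n :
  derive1n n (fun t : R => expR (- (t ^+ 2) / 2)) =
  (fun x => (-1) ^+ n * ((hermite_poly R n).[x] * expR (- (x ^+ 2) / 2))).
Proof.
elim: n => [|n IH]; first by apply/funext => x; rewrite /= expr0 hornerC !mul1r.
rewrite derive1nS IH; apply/funext => x.
have dp : is_derive x 1 (horner (hermite_poly R n)) ((hermite_poly R n)^`()).[x].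
  by split; [exact: derivable_horner|rewrite -derive1E -derivE].
have de : is_derive x 1 (fun t : R => expR (- (t ^+ 2) / 2))
    (- x * expR (- (x ^+ 2) / 2)).
  have dq : is_derive x 1 (fun t : R => - (t ^+ 2) / 2) (- x).
    by apply: is_derive_eq; rewrite /GRing.scale /=; field.
  by apply: is_derive_eq; rewrite /GRing.scale /=; ring.
rewrite derive1E.
have dd : is_derive x 1 (fun t => (-1) ^+ n *
    ((hermite_poly R n).[t] * expR (- (t ^+ 2) / 2)))
    ((-1) ^+ n.+1 * ((hermite_poly R n.+1).[x] * expR (- (x ^+ 2) / 2))).
  by apply: is_derive_eq; rewrite /GRing.scale /= hornerD hornerN hornerM hornerX [(-1) ^+ n.+1]exprS; ring.
exact: derive_val.
Qed.

Lemma hermiteE (R : realType) n (x : R) :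
  hermite n x = (hermite_poly R n).[x] / Num.sqrt (n`!)%:R.
Proof.
rewrite /hermite derive1n_gauss; set p := _.[x]; set c := Num.sqrt _.
have -> : (-1) ^+ n / c * expR (x ^+ 2 / 2) * ((-1) ^+ n * (p * expR (- x ^+ 2 / 2)))
  = ((-1) ^+ n * (-1) ^+ n) * (expR (x ^+ 2 / 2) * expR (- (x ^+ 2) / 2)) * (p / c).
  by ring.
by rewrite -expr2 sqrr_sign -expRD -mulrDl subrr mul0r expR0 !mul1r.
Qed.

Lemma deriv_hermite_poly (R : realType) n :
  (hermite_poly R n.+1)^`() = n.+1%:R *: hermite_poly R n.
Proof.
elim: n => [|n IH]; first by rewrite /= derivC subr0 mulr1 derivX scale1r.
rewrite [hermite_poly R n.+2]/= derivB derivM derivX mul1r.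
rewrite -/(hermite_poly R n.+1) IH derivZ -scalerAr -addrA -scalerBr.
by rewrite -[X in _ *: X]/(hermite_poly R n.+1) [in RHS]mulrS scalerDl scale1r.
Qed.

(** The three-term recurrence, in which the derivative is replaced by a multiple
of the previous polynomial; this is the form that bounds coefficients. *)
Lemma hermite_polySS (R : realType) n :
  hermite_poly R n.+2 = 'X * hermite_poly R n.+1 - n.+1%:R *: hermite_poly R n.
Proof. by rewrite -deriv_hermite_poly. Qed.

Lemma size_hermite_poly (R : realType) n : (size (hermite_poly R n) <= n.+1)%N.
Proof.
elim: n => [|n IH] /=; first by rewrite size_poly1.
apply: leq_trans (size_polyD _ _) _; rewrite geq_max size_polyN; apply/andP; split.
  by rewrite mulrC; apply: leq_trans (size_polyMleq _ _) _; rewrite size_polyX addn2.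
by apply: leq_trans (size_poly _ _) _; apply: leq_trans (leq_pred _) _; exact: leqW.
Qed.

(** In the recurrence, the weighted coefficient sums satisfy
A_(j+2) <= r A_(j+1) + (j+1) A_j with j + 1 <= r^2, so A_j <= (2r)^j implies
A_(j+2) <= (2 r^2 + r^2) (2r)^j <= (2r)^(j+2). *)
Lemma hermite_poly_coef_bound (R : realType) n N (r : R) : 0 < r -> n%:R <= r ^+ 2 ->
  \sum_(i < N) `|(hermite_poly R n)`_i| * r ^+ i <= (2 * r) ^+ n.
Proof.
move=> r0; pose A (p : {poly R}) N := \sum_(i < N) `|p`_i| * r ^+ i.
have A0 p M : 0 <= A p M by apply: sumr_ge0 => i _; rewrite mulr_ge0 ?exprn_ge0 // ltW.
have AX p M : A ('X * p) M <= r * A p M.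
  case: M => [|M]; first by rewrite /A !big_ord0 mulr0.
  rewrite {1}/A big_ord_recl coefXM /= normr0 mul0r add0r.
  rewrite /A big_ord_recr /= mulrDr -[leLHS]addr0 lerD //; last first.
    by rewrite !mulr_ge0 ?exprn_ge0 // ltW.
  rewrite mulr_sumr ler_sum // => i _; rewrite coefXM /= exprS.
  by rewrite mulrCA.
have AB p q c M : 0 <= c -> A (p - c *: q) M <= A p M + c * A q M.
  move=> c0; rewrite /A mulr_sumr -big_split ler_sum // => i _ /=.
  rewrite coefB coefZ mulrA -mulrDl ler_wpM2r ?exprn_ge0 ?(ltW r0) //.
  by apply: le_trans (ler_normB _ _) _; rewrite normrM (ger0_norm c0).
have step j M : j.+1%:R <= r ^+ 2 -> A (hermite_poly R j) M <= (2 * r) ^+ j ->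
    A (hermite_poly R j.+1) M <= (2 * r) ^+ j.+1 ->
    A (hermite_poly R j.+2) M <= (2 * r) ^+ j.+2.
  move=> jr h1 h2; rewrite hermite_polySS.
  apply: le_trans (AB _ _ _ _ (ler0n _ _)) _.
  apply: le_trans (lerD (le_trans (AX _ _) (ler_wpM2l (ltW r0) h2)) _) _.
    by apply: ler_pM jr h1; rewrite ?ler0n.
  by rewrite !exprS; have : 0 <= (2 * r) ^+ j; [rewrite exprn_ge0 // mulr_ge0 // ltW|nra].
have base0 M : A (hermite_poly R 0) M <= (2 * r) ^+ 0.
  case: M => [|M]; first by rewrite /A big_ord0.
  rewrite /A big_ord_recl coef1 /= normr1 mul1r expr0 big1 ?addr0 // => i _.
  by rewrite coef1 /= normr0 mul0r.
(* the recurrence has two predecessors, so two consecutive bounds are proved together *)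
suff both : n%:R <= r ^+ 2 -> A (hermite_poly R n) N <= (2 * r) ^+ n /\
    A (hermite_poly R n.+1) N <= (2 * r) ^+ n.+1 by move=> /both[].
elim: n => [_|n IH nr].
  split; first exact: base0.
  rewrite /= derivC subr0 expr1; apply: le_trans (AX _ _) _.
  by have := base0 N; rewrite expr0; nra.
have [|h1 h2] := IH; first by apply: le_trans nr; rewrite ler_nat.
by split=> //; exact: step.
Qed.

Lemma hermite_poly_bound (R : realType) n (r x : R) : 0 < r -> n%:R <= r ^+ 2 ->
  `|x| <= r -> `|(hermite_poly R n).[x]| <= (2 * r) ^+ n.
Proof.
move=> r0 nr xr; apply: le_trans (hermite_poly_coef_bound (size (hermite_poly R n)) r0 nr).
rewrite horner_coef; apply: le_trans (ler_norm_sum _ _ _) _; apply: ler_sum => i _.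
by rewrite normrM normrX ler_wpM2l // lerXn2r ?nnegrE // ltW.
Qed.

Lemma sqrt_fact_ge1 (R : realType) n : 1 <= Num.sqrt (n`!)%:R :> R.
Proof. by rewrite -[leLHS]sqrtr1 ler_sqrt ?ler1n ?fact_gt0 // ltr0n fact_gt0. Qed.

Lemma hermite_bound (R : realType) n (r x : R) : 0 < r -> n%:R <= r ^+ 2 ->
  `|x| <= r -> `|hermite n x| <= (2 * r) ^+ n.
Proof.
move=> r0 nr xr; rewrite hermiteE normrM normfV (ger0_norm (sqrtr_ge0 _)).
have s1 := sqrt_fact_ge1 R n.
rewrite ler_pdivrMr; last exact: lt_le_trans ltr01 s1.
apply: le_trans (hermite_poly_bound r0 nr xr) _.
by rewrite ler_peMr // exprn_ge0 // mulr_ge0 // ltW.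
Qed.

(** * Integrals against Gaussian measures *)

(** The normal density is the Radon-Nikodym derivative almost everywhere, since
both have the same integrals. *)
Lemma ge0_integral_normal_prob (R : realType) (m s : R) (f : _ -> \bar R) :
  measurable_fun setT f -> (forall x, 0 <= f x)%E ->
  (\int[normal_prob m s]_x f x =
   \int[lebesgue_measure]_x (f x * (normal_pdf m s x)%:E))%E.
Proof.
move=> mf f0; have dom := @normal_prob_dominates R m s.
have mpdf : measurable_fun setT (fun x => (normal_pdf m s x)%:E).
  by apply/measurable_EFinP; exact: measurable_normal_pdf.
rewrite -(Radon_Nikodym_SigmaFinite.change_of_variables dom f0)//.
have igg := Radon_Nikodym_SigmaFinite.f_integrable dom.
apply: ae_eq_integral => //.
- by apply: emeasurable_funM => //; exact: measurable_int igg.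
- exact: emeasurable_funM.
apply: ae_eqe_mul2l => /=; apply: integral_ae_eq => //.
by move=> E _ mE; rewrite -Radon_Nikodym_SigmaFinite.f_integral.
Qed.

(** exp(3x^2/8) exp(-x^2/2) = exp(-x^2/8), which is the shape of the normal
density of standard deviation 2; the normalizing constants differ by the factor 2. *)
Lemma integral_expR_normal_prob01 (R : realType) :
  (\int[normal_prob 0 1]_x (expR (3 / 8 * x ^+ 2))%:E = 2%:E :> \bar R)%E.
Proof.
have s2 : (2 : R) != 0 by rewrite pnatr_eq0.
have mE : measurable_fun setT (fun x : R => (expR (3 / 8 * x ^+ 2))%:E).
  apply/measurable_EFinP/measurableT_comp => //.
  by apply: measurable_funM => //; exact: measurable_funX.
rewrite ge0_integral_normal_prob//.
have pdfE x : expR (3 / 8 * x ^+ 2) * normal_pdf 0 1 x = 2 * normal_pdf 0 2 x :> R.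
  rewrite !normal_pdfE ?oner_neq0// /normal_fun /normal_peak mulrCA -expRD !subr0.
  have -> : Num.sqrt (2 ^+ 2 * pi *+ 2) = 2 * Num.sqrt (1 ^+ 2 * pi *+ 2) :> R.
    by rewrite -mulrnAr sqrtrM ?exprn_ge0// sqrtr_sqr ger0_norm// expr1n mul1r.
  rewrite invfM -!mulrA mulVKf//; congr (_ * expR _).
  by field.
under eq_integral do rewrite -EFinM pdfE EFinM.
rewrite integralZl//; last exact: integrable_normal_pdf.
by rewrite integral_normal_pdf mule1.
Qed.

Lemma Lnorm2_le (d : measure_display) (T : measurableType d) (R : realType)
    (mu : {measure set T -> \bar R}) (f : T -> R) (c : R) : 0 <= c ->
  (\int[mu]_x (f x ^+ 2)%:E <= (c ^+ 2)%:E)%E ->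
  (Lnorm mu 2%:E (EFin \o f) <= c%:E)%E.
Proof.
move=> c0 le; rewrite unlock.
have -> : (\int[mu]_x `|(EFin \o f) x| `^ 2%R = \int[mu]_x (f x ^+ 2)%:E)%E.
  apply: eq_integral => x _; rewrite /=.
  rewrite powR_mulrn ?normr_ge0// real_normK ?num_real//.
apply: (@le_trans _ _ ((c ^+ 2)%:E `^ 2^-1)%E).
  apply: gt0_ler_poweR => //; rewrite in_itv/= leey andbT ?lee_fin ?sqr_ge0//.
  by apply: integral_ge0 => x _; rewrite lee_fin sqr_ge0.
by rewrite poweR_EFin lee_fin powR12_sqrt ?sqr_ge0// sqrtr_sqr ger0_norm.
Qed.

(** The integral of a nonnegative function is the supremum of the integrals of
the simple functions below it, so a pointwise comparison suffices; in particular
the squared error of a network can be compared with a continuous majorant. *)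
Lemma ge0_le_integralT (d : measure_display) (T : measurableType d) (R : realType)
    (mu : {measure set T -> \bar R}) (f g : T -> \bar R) :
  (forall x, 0 <= f x)%E -> (forall x, f x <= g x)%E ->
  (\int[mu]_x f x <= \int[mu]_x g x)%E.
Proof.
move=> f0 fg; have g0 x : (0 <= g x)%E by exact: le_trans (fg x).
rewrite !ge0_integralTE //; apply: le_ereal_sup => _ [h hf <-].
exists h => // x.
exact: le_trans (hf x) (fg x).
Qed.

(** * The tail beyond the cut-off radius *)

Lemma expR_half_le2 (R : realType) : expR 2^-1 <= 2 :> R.
Proof.
have : 2^-1 <= expR (- 2^-1) :> R by apply: le_trans (expR_ge1Dx _); lra.
by rewrite expRN lef_pV2 ?posrE ?expR_gt0.
Qed.

Lemma ln2_ge_half (R : realType) : 2^-1 <= ln 2 :> R.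
Proof. by rewrite -ler_expR lnK ?posrE // expR_half_le2. Qed.

Lemma expR1_le4 (R : realType) : expR 1 <= 4 :> R.
Proof.
have -> : 1 = 2^-1 + 2^-1 :> R by field.
by rewrite expRD; have := expR_half_le2 R; have := expR_ge0 (2^-1 : R); nra.
Qed.

Lemma expR_ge_pow (R : realType) n (x : R) : 0 <= x -> x ^+ n / (n`!)%:R <= expR x.
Proof.
case: n => [|n] x0; first by rewrite expr0 divr1 -[leLHS]expR0 ler_expR.
by apply: le_trans (expR_ge1Dxn n x0); rewrite lerDr.
Qed.

Lemma cutoff_sqr (R : realType) n (eps : R) : (0 < n)%N -> 0 < eps -> eps < expR (-1) ->
  [/\ cutoff n eps ^+ 2 = 24 * (n%:R * ln (2 * n%:R) - ln eps),
      0 < cutoff n eps, n%:R <= 20 * (n%:R * ln (2 * n%:R) - ln eps)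
    & 1 < - ln eps].
Proof.
move=> n0 e0 e1; have ln1 : 1 < - ln eps.
  by rewrite ltrNr -[ltRHS]expRK ltr_ln ?posrE ?expR_gt0.
have n1 : 1 <= n%:R :> R by rewrite ler1n.
have ln2 : 2^-1 <= ln (2 * n%:R) :> R.
  by apply: le_trans (ln2_ge_half R) _; rewrite ler_ln ?posrE; lra.
have nl : n%:R / 2 <= n%:R * ln (2 * n%:R) :> R by rewrite ler_wpM2l ?ler0n.
have L0 : 0 < n%:R * ln (2 * n%:R) - ln eps by lra.
split=> //; last by lra.
- by rewrite /cutoff sqr_sqrtr // mulr_ge0 // ltW.
- by rewrite /cutoff sqrtr_gt0 mulr_gt0.
Qed.

(** With y = x^2 and y >= 20 L, split exp(3y/8) = exp(y/5) exp(7y/40).  The first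
factor is at least exp(4L) = (2n)^(4n) / eps^4, the second at least (7y/40)^n / n!,
while H_n(x)^2 <= (4y)^n / n!.  What remains is 4^n <= 2 (14 n^4 / 5)^n, after
spending 4 eps^2 <= 1. *)
Lemma hermite_tail (R : realType) n (eps x : R) :
  (0 < n)%N -> 0 < eps -> eps < expR (-1) -> 11 / 12 * cutoff n eps <= `|x| ->
  hermite n x ^+ 2 <= eps ^+ 2 / 2 * expR (3 / 8 * x ^+ 2).
Proof.
move=> n0 e0 e1 xM; have [M2 M0 nL l1] := cutoff_sqr n0 e0 e1.
set L := n%:R * _ - _ in M2 nL.
have n1 : 1 <= n%:R :> R by rewrite ler1n.
have L0 : 0 < L by lra.
have xL : 20 * L <= x ^+ 2.
  rewrite -[x ^+ 2]real_normK ?num_real //.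
  apply: (@le_trans _ _ ((11 / 12 * cutoff n eps) ^+ 2)).
    by rewrite exprMn M2; lra.
  by rewrite lerXn2r ?nnegrE // mulr_ge0 // ltW.
have ax0 : 0 < `|x| by apply: lt_le_trans xM; rewrite mulr_gt0.
have H2 : hermite n x ^+ 2 <= (4 * x ^+ 2) ^+ n / (n`!)%:R.
  rewrite hermiteE expr_div_n sqr_sqrtr ?ler0n // ler_wpM2r ?invr_ge0 ?ler0n //.
  rewrite -[leLHS]real_normK ?num_real // (_ : 4 * x ^+ 2 = (2 * `|x|) ^+ 2); last first.
    by rewrite exprMn real_normK ?num_real //; ring.
  rewrite exprAC lerXn2r ?nnegrE ?exprn_ge0 ?mulr_ge0 //.
  apply: hermite_poly_bound => //.
  by rewrite real_normK ?num_real //; lra.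
have E1 : (2 * n%:R) ^+ (4 * n) / eps ^+ 4 <= expR (x ^+ 2 / 5).
  have -> : (2 * n%:R) ^+ (4 * n) / eps ^+ 4 = expR (4 * L) :> R.
    (* expR turns this combination of logarithms into the powers on the left *)
  have -> : 4 * L = (4 * n)%:R * ln (2 * n%:R) + 4%:R * (- ln eps) by rewrite /L natrM; ring.
    rewrite expRD !expRM_natl expRN !lnK ?posrE ?exprVn //.
    by rewrite mulr_gt0 // ltr0n.
  by rewrite ler_expR; lra.
have E2 : (7 / 40 * x ^+ 2) ^+ n / (n`!)%:R <= expR (7 / 40 * x ^+ 2).
  by apply: expR_ge_pow; rewrite mulr_ge0 ?sqr_ge0.
have e2 : 4 * eps ^+ 2 <= 1.
  have : 2 * eps <= 1.
    have := expR_ge1Dx (1 : R); have : expR (-1) * expR 1 = 1 :> R.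
      by rewrite -expRD addNr expR0.
    have := expR_gt0 (-1 : R); nra.
  nra.
apply: le_trans H2 _.
have -> : 3 / 8 * x ^+ 2 = x ^+ 2 / 5 + 7 / 40 * x ^+ 2 by field.
rewrite expRD; apply: (@le_trans _ _ (eps ^+ 2 / 2 * ((2 * n%:R) ^+ (4 * n) / eps ^+ 4
   * ((7 / 40 * x ^+ 2) ^+ n / (n`!)%:R)))); last first.
  rewrite ler_wpM2l ?divr_ge0 ?sqr_ge0 //; apply: ler_pM => //.
    by rewrite divr_ge0 ?exprn_ge0 ?mulr_ge0 ?ler0n // ltW.
  by rewrite divr_ge0 ?ler0n // exprn_ge0 // mulr_ge0 ?sqr_ge0.
have -> : eps ^+ 2 / 2 * ((2 * n%:R) ^+ (4 * n) / eps ^+ 4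
   * ((7 / 40 * x ^+ 2) ^+ n / (n`!)%:R))
   = (2 * eps ^+ 2)^-1 * (14 / 5 * n%:R ^+ 4 * x ^+ 2) ^+ n / (n`!)%:R.
  have -> : (14 / 5 * n%:R ^+ 4 * x ^+ 2) ^+ n
      = (2 * n%:R) ^+ (4 * n) * (7 / 40 * x ^+ 2) ^+ n.
    by rewrite exprM -exprMn; congr (_ ^+ n); field.
  move: ((2 * n%:R) ^+ (4 * n)) ((7 / 40 * x ^+ 2) ^+ n) => A B; field.
  by rewrite gt_eqF ?ltr0n ?fact_gt0 // gt_eqF.
rewrite ler_wpM2r ?invr_ge0 ?ler0n //.
have e2' : 2 <= (2 * eps ^+ 2)^-1.
  rewrite -[leLHS]invrK lef_pV2 ?posrE ?invr_gt0 ?mulr_gt0 ?exprn_gt0 //; lra.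
apply: (@le_trans _ _ (2 * (14 / 5 * n%:R ^+ 4 * x ^+ 2) ^+ n)); last first.
  by rewrite ler_wpM2r // exprn_ge0 // mulr_ge0 ?sqr_ge0 // mulr_ge0 ?exprn_ge0 ?ler0n //.
have x20 := sqr_ge0 x.
case: n n0 {M2 M0 nL l1 L L0 xL E1 E2 e2' xM} n1 => // [[|n]] _ n1.
  by rewrite !expr1 expr1n; lra.
have n16 : 16 <= n.+2%:R ^+ 4 :> R.
  by rewrite -natrX ler_nat (@leq_exp2r 2 n.+2 4).
set z := n.+2%:R ^+ 4 in n16 *.
have le4 : 4 * x ^+ 2 <= 14 / 5 * z * x ^+ 2 by rewrite ler_wpM2r //; lra.
have ge4 : 0 <= 4 * x ^+ 2 by rewrite mulr_ge0.
apply: (@le_trans _ _ ((14 / 5 * z * x ^+ 2) ^+ n.+2)).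
  by rewrite lerXn2r ?nnegrE //; exact: le_trans le4.
by rewrite ler_peMl ?ler1n // exprn_ge0 //; exact: le_trans le4.
Qed.

(** The pointwise bound eps^2 (2 + exp(3x^2/8)) on the squared error covers all
x at once: inside the plateau of the window the error is at most eps, and outside
(|H_n| + eps)^2 <= 2 H_n^2 + 2 eps^2. *)
Lemma clip_hermite_L2 (R : realType) n (eps : R) (Y : R -> R) :
  (0 < n)%N -> 0 < eps -> eps < expR (-1) ->
  let M := cutoff n eps in
  (forall x, `|x| <= M -> `|Y x - hermite n x| <= eps) ->
  (Lnorm (normal_prob 0 1) 2%:E (EFin \o (fun x : R =>
     hermite n x - clip ((2 * M) ^+ n * window M x) (Y x))%R) <= (2 * eps)%:E)%E.
Proof.
move=> n0 e0 e1 M YH; have [M2 M0 nL l1] := cutoff_sqr n0 e0 e1.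
rewrite -/M in M2 M0; set F := fun x => _.
have nM : n%:R <= M ^+ 2 by rewrite M2; have := ler0n R n; lra.
have K0 : 0 <= (2 * M) ^+ n by rewrite exprn_ge0 // mulr_ge0 // ltW.
have ptw x : F x ^+ 2 <= eps ^+ 2 * (2 + expR (3 / 8 * x ^+ 2)).
  have ex0 := expR_ge0 (3 / 8 * x ^+ 2); have ee0 := sqr_ge0 eps.
  have /andP[w0 w1] := window_itv M x.
  (* on the plateau the truncation level is K, which dominates H_n *)
  have inner : `|x| <= 11 / 12 * M -> F x ^+ 2 <= eps ^+ 2.
    move=> xM; have xM' : `|x| <= M by lra.
    rewrite -[leLHS]real_normK ?num_real // lerXn2r ?nnegrE ?(ltW e0) //.
    rewrite /F distrC window1 // mulr1; apply: le_trans (YH x xM').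
    by apply: clip_dist; exact: hermite_bound.
  have [xM|xM] := leP `|x| (11 / 12 * M); first by apply: le_trans (inner xM) _; nra.
  have tail := hermite_tail n0 e0 e1 (ltW xM).
  have Fx : `|F x| <= `|hermite n x| + eps.
    have [xM'|xM'] := leP `|x| M.
      rewrite /F distrC; apply: le_trans (clip_dist_add _ _ _) _.
        by rewrite mulr_ge0.
      by rewrite lerD2l YH.
    by rewrite /F window0 // mulr0 clip0 subr0 lerDl ltW.
  rewrite -[leLHS]real_normK ?num_real //.
  have h0 := normr_ge0 (hermite n x).
  have h2 : `|hermite n x| ^+ 2 = hermite n x ^+ 2 by rewrite real_normK ?num_real.
  have := sqr_ge0 (`|hermite n x| - eps); have f0 := normr_ge0 (F x); nra.
apply: Lnorm2_le; first by lra.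
apply: (@le_trans _ _ (\int[normal_prob 0 1]_x
    ((2 * eps ^+ 2)%:E + (eps ^+ 2)%:E * (expR (3 / 8 * x ^+ 2))%:E))%E).
  apply: ge0_le_integralT => x; first by rewrite lee_fin sqr_ge0.
  by rewrite lee_fin; apply: le_trans (ptw x) _; rewrite mulrDr mulrC.
have mE : measurable_fun setT (fun x : R => (expR (3 / 8 * x ^+ 2))%:E).
  apply/measurable_EFinP/measurableT_comp => //.
  by apply: measurable_funM => //; exact: measurable_funX.
have ee0 := sqr_ge0 eps.
rewrite ge0_integralD //; last 3 first.
- by move=> x _; rewrite lee_fin mulr_ge0.
- by move=> x _; rewrite lee_fin mulr_ge0 ?expR_ge0.
- by apply: measurable_funeM.
rewrite ge0_integralZl // ?lee_fin //.
rewrite integral_cst // integral_expR_normal_prob01.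
rewrite [X in (_ * X)%E](_ : _ = 1%E); last exact: probability_setT.
by rewrite mule1 lee_fin; lra.
Qed.

Lemma hermite_net_of_stack (R : realType) n (eps : R) d s vs (y : R -> R) (c : R) :
  (0 < n)%N -> 0 < eps -> eps < expR (-1) ->
  let M := cutoff n eps in
  stack d s (map (@shift1 R) vs) -> window M \in vs -> y \in vs ->
  (forall x, `|x| <= M -> `|c * y x - hermite n x| <= eps) ->
  exists N : relu_net R 1 1,
    [/\ (Lnorm (normal_prob 0 1) 2%:E
           (EFin \o (fun x : R => hermite n x - realize1 N x)%R) <= (2 * eps)%:E)%E,
        (forall x : R, M < `|x| -> realize1 N x = 0) /\
        (ereal_sup [set `|realize1 N x|%:E | x in [set: R]]
           <= (1 + (3 * M) ^+ n)%:E)%E,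
        (net_size N <= s + 16)%N
      & net_depth N = d.+1].
Proof.
move=> n0 e0 e1 M st win yin yH; have [_ M0 _ _] := cutoff_sqr n0 e0 e1.
rewrite -/M in M0.
have K0 : 0 <= (2 * M) ^+ n by rewrite exprn_ge0 // mulr_ge0 // ltW.
have w0 x : 0 <= window M x by have /andP[] := window_itv M x.
have [N [NE Nd Ns]] := stack_clip c st win yin K0 w0.
exists N; split=> //.
- rewrite (_ : realize1 N = fun x => clip ((2 * M) ^+ n * window M x) (c * y x)).
    exact: clip_hermite_L2.
  exact/funext.
split=> [x xM|]; first by rewrite NE window0 // mulr0 clip0.
apply: ge_ereal_sup => _ [x _ <-]; rewrite lee_fin NE.
apply: le_trans (clip_bound _ (mulr_ge0 K0 (w0 x))) _.
apply: (@le_trans _ _ ((2 * M) ^+ n)).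
  by rewrite ler_piMr //; have /andP[] := window_itv M x.
apply: (@le_trans _ _ ((3 * M) ^+ n)); last by rewrite lerDr.
by rewrite lerXn2r ?nnegrE ?mulr_ge0 ?(ltW M0) // ler_pM2r //; lra.
Qed.

(** * Depth and accuracy of the evaluation *)

(** Each coefficient of H_n / Z in the variable x/M is at most 2^-(k+1), because
Z contains the bound (2M)^n of their sum; this meets the invariant of
[stack_estrin], whose error is then multiplied back by Z. *)
Lemma hermite_stack (R : realType) n k m (M eps : R) :
  0 < M -> n%:R <= M ^+ 2 -> 1 <= 2 * M -> 0 < eps -> eps <= 1 ->
  (n.+1 <= 2 ^ k)%N -> 2 * 8 ^+ k * (2 * M) ^+ n <= eps * 4 ^+ m.+1 ->
  exists vs (y : R -> R) (c : R),
    [/\ stack (2 + k * (m + 3)) (18 + 5 * n.+1 + 28 * (m + 3) * (3 * (2 ^ k - 1)))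
          (map (@shift1 R) vs), window M \in vs, y \in vs
      & forall x, `|x| <= M -> `|c * y x - hermite n x| <= eps].
Proof.
move=> M0 nM M1 e0 e1 nk mP; set e := (4 ^+ m.+1)^-1 : R.
have [M20 k0] : 0 < (2 * M) ^+ n /\ 0 < 2 ^+ k :> R by rewrite !exprn_gt0 ?mulr_gt0.
pose Z := (2 * M) ^+ n * 2 ^+ k.+1.
have Z0 : 0 < Z by apply: mulr_gt0 => //; exact: exprn_gt0.
have s1 := sqrt_fact_ge1 R n.
have s0 : 0 < Num.sqrt (n`!)%:R :> R by exact: lt_le_trans ltr01 s1.
set q := Num.sqrt _ in s1 s0.
pose a i := (hermite_poly R n)`_i * M ^+ i / (q * Z).
have ab i : (i < n.+1)%N -> `|a i| <= (2 ^+ k.+1)^-1.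
  move=> lt_i; rewrite normrM normfV (gtr0_norm (mulr_gt0 s0 Z0)) ler_pdivrMr ?mulr_gt0 //.
  rewrite /Z mulrCA [X in _ <= q * X]mulrC -mulrA divff ?mulr1 ?expf_neq0 //.
  apply: (@le_trans _ _ ((2 * M) ^+ n)); last by rewrite ler_peMl // ltW.
  apply: le_trans (hermite_poly_coef_bound n.+1 M0 nM).
  rewrite (bigD1 (Ordinal lt_i)) //= normrM normrX (gtr0_norm M0) lerDl.
  by apply: sumr_ge0 => j _; rewrite mulr_ge0 // exprn_ge0 // ltW.
have e4 : 4 ^+ k = 2 ^+ k * 2 ^+ k :> R by rewrite -exprMn; congr (_ ^+ k); ring.
have e8 : 8 ^+ k = 2 ^+ k * 4 ^+ k :> R by rewrite -exprMn; congr (_ ^+ k); ring.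
have mP' : Z * (4 ^+ k * e) <= eps.
  rewrite mulrA /e ler_pdivrMr ?exprn_gt0 //; apply: le_trans mP.
  by rewrite /Z exprS e8; rewrite le_eqVlt; apply/orP; left; apply/eqP; ring.
have k1 : 1 <= 2 ^+ k :> R by rewrite exprn_ege1 // ler1n.
(* Z 4^k e <= eps <= 1, and the left side is 2 (2M)^n 4^k >= 2 times 2^k e *)
have eh : 2 ^+ k * e <= 2^-1.
  have w1 : 1 <= (2 * M) ^+ n by rewrite exprn_ege1.
  have x0 : 0 <= 2 ^+ k * e by rewrite mulr_ge0 ?invr_ge0 ?exprn_ge0.
  have : (2 * M) ^+ n * (2 ^+ k * 2 ^+ k) * (2 * (2 ^+ k * e)) <= 1.
    apply: le_trans e1; apply: le_trans mP'.
    by rewrite /Z exprS e4; rewrite le_eqVlt; apply/orP; left; apply/eqP; ring.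
  have : 1 <= (2 * M) ^+ n * (2 ^+ k * 2 ^+ k) by rewrite -[leLHS]mulr1 ler_pM ?mulr_ege1 // mulr_ge0.
  by move: (_ * (2 ^+ k * 2 ^+ k)) (2 ^+ k * e) x0 => u v; nra.
have a1 : {in mkseq a n.+1, forall c, `|c| <= 1}.
  move=> c /mapP[i]; rewrite mem_iota add0n => /andP[_ lt_i] ->.
  by apply: le_trans (ab i lt_i) _; rewrite invf_le1 ?exprn_gt0 // exprn_ege1 // ler1n.
have := @stack_estrin R m k _ _ _ _ _ ((2 ^+ k.+1)^-1) (stack_start M a1).
rewrite -/e size_map size_mkseq => -[//||x|x|_ /mapP[c cin ->] x||].
- exact: nk.
- by have /andP[? ?] := window_itv M x; rewrite ger0_norm.
- exact: clamp_le1.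
- case/mapP: cin => i; rewrite mem_iota add0n => /andP[_ lt_i] ->; exact: ab.
- by rewrite mulrDr exprS invfM mulrCA divff ?mulr1 ?expf_neq0 //; lra.
move=> t' [y [sty yE]]; exists [:: window M; t'; y], y, Z.
split=> //; rewrite ?inE ?eqxx ?orbT // => x xM.
have evE : horner_seq (map (fun p : R -> R => p x) (map (fun c => cst c) (mkseq a n.+1)))
    (clamp M x) = hermite n x / Z.
  rewrite -map_comp (_ : map _ _ = mkseq a n.+1); last exact: map_id.
  rewrite horner_seq_mkseq clampE // hermiteE (horner_coef_wide x (size_hermite_poly R n)).
  rewrite -/q !mulr_suml; apply: eq_bigr => i _.
  by rewrite /a expr_div_n; field; rewrite !gt_eqF // exprn_gt0.
rewrite (_ : _ - _ = Z * (y x - hermite n x / Z)); last by field; rewrite gt_eqF.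
rewrite normrM (gtr0_norm Z0); apply: le_trans mP'; rewrite ler_pM2l //.
by rewrite -evE; exact: yE.
Qed.

Lemma ln_pow (R : realType) n (x : R) : 0 < x -> ln (x ^+ n) = n%:R * ln x.
Proof. by move=> x0; rewrite lnXn // mulr_natl. Qed.

Lemma cutoff_ge1 (R : realType) n (eps : R) : (0 < n)%N -> 0 < eps -> eps < expR (-1) ->
  1 <= cutoff n eps.
Proof.
move=> n0 e0 e1; have [M2 M0 nL l1] := cutoff_sqr n0 e0 e1.
have n1 : 1 <= n%:R :> R by rewrite ler1n.
have nl : 0 <= n%:R * ln (2 * n%:R) :> R by rewrite mulr_ge0 // ln_ge0 //; lra.
by rewrite -(@ler_pXn2r _ 2) ?nnegrE ?(ltW M0) // expr1n M2; lra.
Qed.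

(** L <= 3 n^2 ln(1/eps), since both summands of L are at most a multiple of the
product n^2 ln(1/eps); hence (2M)^2 <= 2^9 n^2 ln(1/eps). *)
Lemma ln_cutoff_bound (R : realType) n (eps : R) :
  (0 < n)%N -> 0 < eps -> eps < expR (-1) ->
  ln (2 * cutoff n eps) <= 5 + ln n%:R + ln (- ln eps).
Proof.
move=> n0 e0 e1; have [M2 M0 nL l1] := cutoff_sqr n0 e0 e1.
have n1 : 1 <= n%:R :> R by rewrite ler1n.
set l := - ln eps in M2 nL l1 *; set M := cutoff n eps in M2 M0 *.
have ln2n : ln (2 * n%:R) <= 2 * n%:R :> R by rewrite ltW // ln_sublinear; lra.
have L3 : M ^+ 2 <= 72 * (n%:R ^+ 2 * l).
  rewrite M2; have : n%:R * ln (2 * n%:R) <= n%:R * (2 * n%:R) :> R by rewrite ler_wpM2l.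
  have nn : 1 <= n%:R ^+ 2 :> R by rewrite exprn_ege1.
  have h1 : l <= n%:R ^+ 2 * l by rewrite ler_peMl //; lra.
  have h2 : n%:R ^+ 2 <= n%:R ^+ 2 * l by rewrite ler_peMr //; lra.
  by rewrite !expr2 in h1 h2 *; lra.
have l0 : 0 <= ln l by apply: ln_ge0; exact: ltW.
have u0 : 0 < n%:R ^+ 2 * l by apply: mulr_gt0; [apply: exprn_gt0|]; lra.
have M20 : 0 < 2 * M by apply: mulr_gt0.
have le_sq : (2 * M) ^+ 2 <= 2 ^+ 9 * (n%:R ^+ 2 * l) by lra.
have : ln ((2 * M) ^+ 2) <= ln (2 ^+ 9 * (n%:R ^+ 2 * l)).
  by rewrite ler_ln ?posrE // ?exprn_gt0 // mulr_gt0 // exprn_gt0.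
have -> : ln ((2 * M) ^+ 2) = 2 * ln (2 * M) by exact: ln_pow.
have -> : ln (2 ^+ 9 * (n%:R ^+ 2 * l)) = 9 * ln 2 + (2 * ln n%:R + ln l) :> R.
  rewrite lnM ?posrE ?exprn_gt0 // [ln (_ * l)]lnM ?posrE ?exprn_gt0 //; try lra.
  by rewrite !ln_pow ?ltr0n.
have : ln 2 <= 1 :> R.
  by rewrite (_ : 2 = 1 + 1 :> R) ?le_ln1Dx //; lra.
by have := ln_ge0 n1; lra.
Qed.

(** The number m of tooth iterates is the integer part of ln X, where
X = 2 * 8^k * (2M)^n / eps is the precision required; 4^(m+1) >= exp(m+1) >= X.
All parts of ln X are absorbed by B because ln n >= 1/2 when n >= 2. *)
Lemma accuracy_bound (R : realType) n (eps : R) :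
  (1 < n)%N -> 0 < eps -> eps < expR (-1) ->
  let k := (trunc_log 2 n).+1 in
  let B := n%:R * ln n%:R + n%:R * ln (- ln eps) - ln eps in
  [/\ (n < 2 ^ k <= 2 * n)%N, k%:R <= 4 * ln n%:R :> R, 1 <= B &
    exists m, 2 * 8 ^+ k * (2 * cutoff n eps) ^+ n <= eps * 4 ^+ m.+1 /\
      (m + 3)%:R <= 30 * B].
Proof.
move=> n1 e0 e1 k; have n0 := ltnW n1; have [M2 M0 nL l1] := cutoff_sqr n0 e0 e1.
have lnM := ln_cutoff_bound n0 e0 e1.
set l := - ln eps in l1 lnM *; set M := cutoff n eps in M2 M0 lnM *; set mu := ln l in lnM *.
set lam := ln n%:R in lnM * => B.
have n2 : 2 <= n%:R :> R by rewrite ler_nat.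
have lam2 : 2^-1 <= lam.
  by apply: le_trans (ln2_ge_half R) _; rewrite ler_ln ?posrE; lra.
have mu0 : 0 <= mu by apply: ln_ge0; exact: ltW.
have nlam : 2 * lam <= n%:R * lam by rewrite ler_pM2r; lra.
have nmu : 0 <= n%:R * mu by rewrite mulr_ge0.
have tk : (2 ^ trunc_log 2 n <= n)%N by exact: trunc_logP.
have ln21 : ln 2 <= 1 :> R.
  by rewrite (_ : 2 = 1 + 1 :> R) ?le_ln1Dx //; lra.
have kl : k%:R <= 4 * lam.
  have : (trunc_log 2 n)%:R * ln 2 <= lam.
    rewrite mulr_natl -lnXn // ler_ln ?posrE ?exprn_gt0 //; last by lra.
    by rewrite -natrX ler_nat.
  rewrite /k -natr1; have := ln2_ge_half R; have : 0 <= (trunc_log 2 n)%:R :> R by [].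
  by nra.
have B1 : 1 <= B by rewrite /B; lra.
split=> //; first by rewrite trunc_log_ltn //= expnS leq_mul2l.
pose X := 2 * 8 ^+ k * (2 * M) ^+ n / eps.
have X0 : 0 < X by rewrite divr_gt0 ?mulr_gt0 ?exprn_gt0 ?mulr_gt0.
have lnX : ln X = ln 2 + k%:R * (3 * ln 2) + n%:R * ln (2 * M) + l.
  have p8 : 0 < 8 ^+ k :> R by rewrite exprn_gt0.
  have pM : 0 < (2 * M) ^+ n by rewrite exprn_gt0 // mulr_gt0.
  have p28 : 0 < 2 * 8 ^+ k :> R by rewrite mulr_gt0.
  have l8 : ln 8 = 3 * ln 2 :> R by rewrite -ln_pow //; congr ln; ring.
  rewrite /X ln_div ?posrE ?(mulr_gt0 p28) // (exp.lnM p28 pM) (exp.lnM _ p8) ?posrE //.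
  by rewrite (ln_pow _ (mulr_gt0 _ M0)) // ln_pow // l8.
have lnXB : ln X <= 27 * B.
  rewrite lnX; have : n%:R * ln (2 * M) <= n%:R * (5 + lam + mu) by rewrite ler_pM2l //; lra.
  have : n%:R * (5 + lam + mu) <= 11 * (n%:R * lam) + n%:R * mu.
    have : n%:R * 5 <= n%:R * (10 * lam) by rewrite ler_pM2l; lra.
    by lra.
  have : k%:R * (3 * ln 2) <= 12 * lam.
    by have := ler0n R k; have := ln2_ge_half R; nra.
  by rewrite /B; lra.
have lnX0 : 0 <= ln X.
  rewrite lnX; have : 0 <= n%:R * ln (2 * M).
    by rewrite mulr_ge0 // ln_ge0 //; have := cutoff_ge1 n0 e0 e1; rewrite -/M; lra.
  have : 0 <= k%:R * (3 * ln 2) :> R by rewrite mulr_ge0 // mulr_ge0 // ln_ge0 // ler1n.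
  by have := ln2_ge_half R; lra.
have /andP[m1 m2] := truncn_itv lnX0.
exists (Num.truncn (ln X)); split; last by rewrite natrD; lra.
have : X <= 4 ^+ (Num.truncn (ln X)).+1.
  rewrite -[leLHS]lnK ?posrE //; apply: (@le_trans _ _ (expR (Num.truncn (ln X)).+1%:R)).
    by rewrite ler_expR ltW.
  rewrite -[X in expR X]mulr1 expRM_natl lerXn2r ?nnegrE ?expR_ge0 //.
  exact: expR1_le4.
by rewrite /X ler_pdivrMr // [_ * eps]mulrC.
Qed.

(** * Approximation of Hermite polynomials *)

Theorem corollary3p5 (R : realType) :
  exists2 C : R, 0 < C &
  forall (n : nat) (eps : R), (1 <= n)%N -> 0 < eps -> eps < expR (-1) ->
  let M := cutoff n eps in
  exists N : relu_net R 1 1,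
    [/\ (Lnorm gamma1 2%:E
           (EFin \o (fun x : R => hermite n x - realize1 N x)%R) <= (2 * eps)%:E)%E,
        (forall x : R, M < `|x| -> realize1 N x = 0) /\
        (ereal_sup [set `|realize1 N x|%:E | x in [set: R]]
           <= (1 + (3 * M) ^+ n)%:E)%E,
        (net_size N)%:R <=
          C * (1 + n%:R ^+ 2 * (ln n%:R + ln (- ln eps)) + n%:R * ln (n%:R / eps))
      & (net_depth N)%:R <=
          C * (1 + n%:R * ln n%:R ^+ 2 + n%:R * ln n%:R * ln (- ln eps)
               - ln n%:R * ln eps)].
Proof.
(* 5040 n B + 39 + 5 n bounds the size, and 120 ln n * B + 3 the depth, with B >= 1 *)
exists 6000; first by rewrite ltr0n.
move=> n eps n0 e0 e1 M.
have [M2 M0 nL l1] := cutoff_sqr n0 e0 e1.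
have mu0 : 0 <= ln (- ln eps) by apply: ln_ge0; exact: ltW.
have npos : 0 < n%:R :> R by rewrite ltr0n.
rewrite ln_div ?posrE //; rewrite -/M in M2 M0.
(* for n = 1, log n = 0 leaves a constant as depth bound: no product can be afforded *)
case: (ltnP 1 n) => [n1|n_le1]; last first.
  have nE : n = 1%N by apply/eqP; rewrite eqn_leq n_le1.
  have st : stack 2 18 (map (@shift1 R) [:: window M; clamp M]).
    by apply: (stack_start M (cs := [::])).
  have yH x : `|x| <= M -> `|M * clamp M x - hermite n x| <= eps.
    move=> xM; rewrite clampE // hermiteE nE /= derivC subr0 mulr1 hornerX.
    rewrite (_ : 1`! = 1%N) // sqrtr1 divr1 mulrC divfK ?gt_eqF // subrr normr0.
    exact: ltW.
  have [||N [L2 sup Ns Nd]] := hermite_net_of_stack n0 e0 e1 st _ _ yH.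
  - by rewrite mem_head.
  - by rewrite !inE eqxx orbT.
  exists N; split=> //.
    apply: (@le_trans _ _ 34%:R); first by rewrite ler_nat.
    by rewrite nE ln1 expr1n !mul1r !add0r; lra.
  by rewrite Nd nE ln1 expr0n /= !mul0r !mulr0 mul0r subr0 !addr0 mulr1 ler_nat.
have [nk kl B1 [m [acc mB]]] := accuracy_bound n1 e0 e1.
case/andP: nk => nk kn; set k := (trunc_log 2 n).+1 in nk kn kl acc.
set B := _ - ln eps in B1 mB.
have [|||vs [y [c [st win yin yH]]]] := hermite_stack M0 _ _ e0 _ nk acc.
- by rewrite M2; lra.
- by have := cutoff_ge1 n0 e0 e1; rewrite -/M; lra.
- by apply: ltW; apply: lt_le_trans e1 _; rewrite expR_le1; lra.
have [N [L2 sup Ns Nd]] := hermite_net_of_stack n0 e0 e1 st win yin yH.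
have n2 : 2 <= n%:R :> R by rewrite ler_nat.
have lam0 : 0 <= ln n%:R :> R by apply: ln_ge0; lra.
exists N; split=> //.
  apply: (@le_trans _ _ (39 + 5 * n%:R + 84 * ((m + 3)%:R * (2 * n%:R)))).
    apply: (@le_trans _ _ (39 + 5 * n + 84 * ((m + 3) * (2 * n)))%N%:R).
      rewrite ler_nat; apply: leq_trans Ns _.
      have : ((m + 3) * (2 ^ k - 1) <= (m + 3) * (2 * n))%N.
        by rewrite leq_mul2l; apply/orP; right; apply: leq_trans kn; exact: leq_subr.
      rewrite mulnACA; move: (_ * (_ - 1))%N (_ * (2 * n))%N => u v uv.
      by clear -uv; lia.
    by rewrite !(natrD, natrM) lexx.
  have h1 : (m + 3)%:R * (2 * n%:R) <= 30 * B * (2 * n%:R) by rewrite ler_wpM2r //; lra.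
  have h2 : n%:R <= n%:R * B by rewrite ler_peMr // ltW.
  have h3 : n%:R * B = n%:R ^+ 2 * (ln n%:R + ln (- ln eps)) - n%:R * ln eps.
    by rewrite /B; ring.
  have h4 : 0 <= n%:R * ln n%:R :> R by rewrite mulr_ge0 // ltW.
  by lra.
rewrite Nd; apply: (@le_trans _ _ (3 + k%:R * (m + 3)%:R)).
  by rewrite -natrM -natrD ler_nat addnC; clear; lia.
have h1 : k%:R * (m + 3)%:R <= 4 * ln n%:R * (30 * B) by rewrite ler_pM.
have h2 : ln n%:R * B = n%:R * ln n%:R ^+ 2 + n%:R * ln n%:R * ln (- ln eps)
    - ln n%:R * ln eps by rewrite /B; ring.
have h3 : 0 <= ln n%:R * B by rewrite mulr_ge0 //; lra.
lra.
Qed.
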